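(* Let $R$ be a commutative ring and let $(A,\mu_1,\mu_2,\mu_3,\ldots)$ be an $A_\infty$ algebra over $R$. For each $k\ge1$ let $\Delta_{3-2k}:TA\to TA$ be the coderivation of degree $3-2k$ of the tensor coproduct extending $\mu_k:A^{\otimes k}\to A$, and let $\bullet$ be the shuffle product on $TA$. Then $(TA,\bullet,\Delta_1,\Delta_{-1},\Delta_{-3},\ldots)$ is a commutative $BV_\infty$ algebra (in the sense of Kravchenko).
   Context: All tensor products are over $R$, $A$ is a graded $R$-module, $TA=\bigoplus_{n\ge0}A^{\otimes n}$ with $A^{\otimes0}=R$, and for homogeneous $a_i\in A$ the monomial $a_1\otimes\cdots\otimes a_n$ has degree $|a_1|+\cdots+|a_n|+n$ in $TA$. Shuffle product: $\bullet:TA\otimes TA\to TA$ is the $R$-linear map determined by $$(a_1\otimes\cdots\otimes a_n)\bullet(a_{n+1}\otimes\cdots\otimes a_{n+m})=\sum_{\sigma\in S(n,m)}(-1)^{\kappa}\,a_{\sigma^{-1}(1)}\otimes\cdots\otimes a_{\sigma^{-1}(n+m)},$$ where $S(n,m)$ is the set of permutations $\sigma\in\Sigma_{n+m}$ with $\sigma(1)<\dots<\sigma(n)$ and $\sigma(n+1)<\dots<\sigma(n+m)$, and $\kappa$ is the sum of $(|a_i|+1)(|a_j|+1)$ over all pairs $i<j$ with $\sigma(i)>\sigma(j)$. $A_\infty$ algebra: a graded $R$-module $A$ with $R$-linear maps $\mu_k:A^{\otimes k}\to A$ of degree $2-k$, $k\ge1$, such that their lifts to coderivations $\Delta_{3-2k}:TA\to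 TA$ of the tensor (deconcatenation) coproduct, which have degree $3-2k$, satisfy $\sum_{j+k=n}\Delta_j\Delta_k=0$ for every $n$ (sum over indices $j,k\in\{1,-1,-3,\dots\}$). Explicitly, $$\Delta_{3-2k}(a_1\otimes\cdots\otimes a_m)=\sum_{i=1}^{m-k+1}(-1)^{\epsilon_i}\,a_1\otimes\cdots\otimes a_{i-1}\otimes\mu_k(a_i\otimes\cdots\otimes a_{i+k-1})\otimes a_{i+k}\otimes\cdots\otimes a_m,$$ $$\epsilon_i=\sum_{l=1}^{i-1}(|a_l|+1)+\sum_{l=1}^{k}(k-l)|a_{i+l-1}|,$$ and $\Delta_{3-2k}=0$ on $A^{\otimes m}$ for $m<k$. Operator-order: let $(X,\bullet)$ be a graded commutative associative algebra and $n\ge1$. A linear operator $\Delta:X\to X$ has operator-order $n$ if for all homogeneous $x_1,\dots,x_{n+1}\in X$, $$\sum(-1)^{n+1-r+\kappa}\,\Delta(x_{i_1}\bullet\cdots\bullet x_{i_r})\bullet x_{i_{r+1}}\bullet\cdots\bullet x_{i_{n+1}}=0,$$ where the sum is over nonempty subsets $\{i_1<\dots<i_r\}\subseteq\{1,\dots,n+1\}$, the complement is ordered $i_{r+1}<\cdots<i_{n+1}$, and $(-1)^\kappa$ is the Koszul sign of rearranging $x_1,\dots,x_{n+1}$ into $x_{i_1},\dots,x_{i_{n+1}}$ (a factor $(-1)^{|x_p||x_q|}$ for each pair $p<q$ whose order is reversed). A (Kravchenko) commutative $BV_\infty$ algebra consists of a graded commutative differential graded associative algebra $(X,d,\bullet)$,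 with $d$ of degree $+1$, and operators $\Delta_k:X\to X$ for $k=1,-1,-3,-5,\ldots$ such that: $\Delta_1=d$; for each $k\ge1$, $\Delta_{3-2k}$ has degree $3-2k$ and operator-order $k$; and for each $n$, $\sum_{j+k=n}\Delta_j\Delta_k=0$. *)

(* Defs.v *)
From HB Require Import structures.
From mathcomp Require Import all_boot fingroup perm all_algebra.
From mathcomp Require Import boolp zify.

Set Implicit Arguments.
Unset Strict Implicit.
Unset Printing Implicit Defensive.

Import GRing.Theory.
Local Open Scope ring_scope.

(* Direct sum of a family of modules: dependent functions of finite support. *)
Section DirectSum.
Variables (R : pzRingType) (I : eqType) (M : I -> lmodType R).

Record dsum := DSum {
  dsum_fun :> forall i, M i;
  dsum_finite : exists s : seq I, forall i, i \notin s -> dsum_fun i = 0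
}.

Lemma dsumP (f g : dsum) : (forall i, f i = g i) -> f = g.
Proof.
case: f g => [f hf] [g hg] /= fg.
have {}fg : f = g by apply: functional_extensionality_dep.
by case: _ / fg hg => hg; congr DSum; exact: Prop_irrelevance.
Qed.

HB.instance Definition _ := gen_eqMixin dsum.
HB.instance Definition _ := gen_choiceMixin dsum.

Fact dsum_zero_finite : exists s : seq I, forall i, i \notin s -> (0 : M i) = 0.
Proof. by exists [::]. Qed.
Definition dsum_zero := DSum dsum_zero_finite.

Fact dsum_opp_finite (f : dsum) :
  exists s : seq I, forall i, i \notin s -> - f i = 0.
Proof. by have [s hs] := dsum_finite f; exists s => i /hs ->; rewrite oppr0. Qed.
Definition dsum_opp f := DSum (dsum_opp_finite f).

Fact dsum_add_finite (f g : dsum) :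
  exists s : seq I, forall i, i \notin s -> f i + g i = 0.
Proof.
have [s hs] := dsum_finite f; have [t ht] := dsum_finite g.
exists (s ++ t) => i; rewrite mem_cat negb_or => /andP[/hs -> /ht ->].
by rewrite addr0.
Qed.
Definition dsum_add f g := DSum (dsum_add_finite f g).

Fact dsum_scale_finite c (f : dsum) :
  exists s : seq I, forall i, i \notin s -> c *: f i = 0.
Proof. by have [s hs] := dsum_finite f; exists s => i /hs ->; rewrite scaler0. Qed.
Definition dsum_scale c f := DSum (dsum_scale_finite c f).

Fact dsum_addA : associative dsum_add.
Proof. by move=> f g h; apply: dsumP => i /=; rewrite addrA. Qed.
Fact dsum_addC : commutative dsum_add.
Proof. by move=> f g; apply: dsumP => i /=; rewrite addrC. Qed.
Fact dsum_add0 : left_id dsum_zero dsum_add.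
Proof. by move=> f; apply: dsumP => i /=; rewrite add0r. Qed.
Fact dsum_addN : left_inverse dsum_zero dsum_opp dsum_add.
Proof. by move=> f; apply: dsumP => i /=; rewrite addNr. Qed.
HB.instance Definition _ :=
  GRing.isZmodule.Build dsum dsum_addA dsum_addC dsum_add0 dsum_addN.

Fact dsum_scaleA a b f : dsum_scale a (dsum_scale b f) = dsum_scale (a * b) f.
Proof. by apply: dsumP => i /=; rewrite scalerA. Qed.
Fact dsum_scale1 : left_id 1 dsum_scale.
Proof. by move=> f; apply: dsumP => i /=; rewrite scale1r. Qed.
Fact dsum_scaleDr : right_distributive dsum_scale +%R.
Proof. by move=> c f g; apply: dsumP => i /=; rewrite scalerDr. Qed.
Fact dsum_scaleDl f : {morph dsum_scale^~ f : a b / a + b}.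
Proof. by move=> a b; apply: dsumP => i /=; rewrite scalerDl. Qed.
HB.instance Definition _ :=
  GRing.Zmodule_isLmodule.Build R dsum
    dsum_scaleA dsum_scale1 dsum_scaleDr dsum_scaleDl.

Definition dsum_in_fun i (v : M i) j : M j :=
  if i =P j is ReflectT e then eq_rect i M v j e else 0.
Fact dsum_in_finite i (v : M i) :
  exists s : seq I, forall j, j \notin s -> dsum_in_fun v j = 0.
Proof.
exists [:: i] => j; rewrite inE eq_sym => /eqP ne_ij.
by rewrite /dsum_in_fun; case: eqP.
Qed.
Definition dsum_in i (v : M i) : dsum := DSum (dsum_in_finite v).

Definition dsum_supp (f : dsum) : seq I := undup (projT1 (cid (dsum_finite f))).

Lemma dsum_suppP f i : i \notin dsum_supp f -> f i = 0.
Proof. by rewrite mem_undup; apply: (projT2 (cid (dsum_finite f))). Qed.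

Lemma dsum_in_id i (v : M i) : dsum_in v i = v.
Proof.
rewrite /= /dsum_in_fun; case: eqP => // e.
by rewrite (Prop_irrelevance e (erefl i)).
Qed.

Lemma dsum_in_neq i (v : M i) j : i != j -> dsum_in v j = 0.
Proof. by move=> /eqP ne_ij; rewrite /= /dsum_in_fun; case: eqP. Qed.

Lemma dsum_funD (f g : dsum) i : (f + g) i = f i + g i. Proof. by []. Qed.
Lemma dsum_funZ c (f : dsum) i : (c *: f) i = c *: f i. Proof. by []. Qed.
Lemma dsum_fun0 i : (0 : dsum) i = 0. Proof. by []. Qed.
Lemma dsum_fun_sum (J : Type) (s : seq J) (F : J -> dsum) i :
  (\sum_(j <- s) F j) i = \sum_(j <- s) F j i.
Proof. by elim/big_rec2: _ => // j y x _ <-. Qed.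

Lemma dsum_in_linear i : linear (@dsum_in i).
Proof.
move=> c u v; apply: dsumP => j.
rewrite dsum_funD dsum_funZ; have [<-|ne_ij] := eqVneq i j.
  by rewrite !dsum_in_id.
by rewrite !dsum_in_neq // scaler0 addr0.
Qed.
HB.instance Definition _ i :=
  GRing.isLinear.Build R (M i) dsum *:%R (@dsum_in i) (@dsum_in_linear i).

Lemma dsum_decomp (f : dsum) : f = \sum_(i <- dsum_supp f) dsum_in (f i).
Proof.
apply: dsumP => j; rewrite dsum_fun_sum.
have [js|js] := boolP (j \in dsum_supp f); last first.
  rewrite dsum_suppP // big_seq big1 // => i si; rewrite dsum_in_neq //.
  by apply: contraNneq js => <-.
rewrite (bigD1_seq j) ?undup_uniq // [X in _ = X + _]dsum_in_id.
by rewrite big1 ?addr0 // => i ne; exact: (dsum_in_neq (f i) ne).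
Qed.

Lemma dsum_lift (N : lmodType R) (h : forall i, {linear M i -> N}) :
  exists L : {linear dsum -> N}, forall i v, L (dsum_in v) = h i v.
Proof.
pose L (f : dsum) := \sum_(i <- dsum_supp f) h i (f i).
have LE (f : dsum) (s : seq I) : uniq s -> (forall i, i \notin s -> f i = 0) ->
    L f = \sum_(i <- s) h i (f i).
  move=> us sP.
  have aux t : \sum_(i <- t) h i (f i) = \sum_(i <- t | f i != 0) h i (f i).
    rewrite (bigID (fun i => f i != 0)) /= [X in _ + X]big1 ?addr0 //.
    by move=> i /negPn /eqP ->; rewrite linear0.
  rewrite /L aux [RHS]aux -big_filter -[RHS]big_filter; apply: perm_big.
  apply: uniq_perm; rewrite ?filter_uniq ?undup_uniq // => i.
  rewrite !mem_filter; have [//|/= nz] := eqVneq (f i) 0.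
  have -> : i \in dsum_supp f by apply: contraNT nz => /dsum_suppP ->.
  by symmetry; apply: contraNT nz => /sP ->.
have Llin : linear L.
  move=> c f g; pose s := undup (dsum_supp f ++ dsum_supp g).
  have sP i : i \notin s -> f i = 0 /\ g i = 0.
    by rewrite mem_undup mem_cat negb_or => /andP[/dsum_suppP -> /dsum_suppP ->].
  rewrite !(@LE _ s) ?undup_uniq //; last 3 first.
  - by move=> i /sP[].
  - by move=> i /sP[].
  - by move=> i /sP[fi gi]; rewrite dsum_funD dsum_funZ fi gi scaler0 addr0.
  rewrite scaler_sumr -big_split; apply: eq_bigr => i _ /=.
  exact: linearP.
pose Lm := GRing.isLinear.Build R dsum N *:%R L Llin.
pose LL : {linear dsum -> N} := HB.pack L Lm.
exists LL => i v; change (L (dsum_in v) = h i v).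
rewrite (@LE _ [:: i]) // ?big_seq1 ?dsum_in_id // => j.
by rewrite inE eq_sym => ne; rewrite dsum_in_neq.
Qed.

End DirectSum.

Inductive lspan (R : pzRingType) (V : lmodType R) (G : V -> Prop) : V -> Prop :=
| lspan0 : lspan G 0
| lspan_step c x y : G x -> lspan G y -> lspan G (c *: x + y).

Section Lspan.
Variables (R : pzRingType) (V : lmodType R) (G : V -> Prop).
Lemma lspan_submod c x y : lspan G x -> lspan G y -> lspan G (c *: x + y).
Proof.
move=> hx hy; elim: hx => [|a u v Gu _ IH]; first by rewrite scaler0 add0r.
by rewrite scalerDr scalerA -addrA; apply: lspan_step.
Qed.
End Lspan.

(* The n-th tensor power: the free R-module on n-tuples of elements of A, modulo
   the submodule generated by the multilinearity relations. Its universal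
   property is tpow_lift. *)
Section TensorPower.
Variables (R : comPzRingType) (A : lmodType R) (n : nat).

Definition free_tuple := dsum (fun _ : n.-tuple A => R^o).
HB.instance Definition _ := GRing.Lmodule.on free_tuple.

Definition free_gen (t : n.-tuple A) : free_tuple :=
  @dsum_in R _ (fun=> R^o) t (1 : R).

Definition multilinear_rel (x : free_tuple) : Prop :=
  exists (i : 'I_n) (c : R) (t t1 t2 : n.-tuple A),
    [/\ tnth t i = c *: tnth t1 i + tnth t2 i,
        forall j, j != i -> tnth t1 j = tnth t j /\ tnth t2 j = tnth t j
      & x = free_gen t - (c *: free_gen t1 + free_gen t2)].

Definition multilinear_relb : {pred free_tuple} :=
  fun x => `[< lspan multilinear_rel x >].

Fact multilinear_rel_submod : submod_closed multilinear_relb.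
Proof.
split; first by apply/asboolP; exact: lspan0.
by move=> c x y /asboolP hx /asboolP hy; apply/asboolP; exact: lspan_submod.
Qed.
HB.instance Definition _ :=
  GRing.isSubmodClosed.Build R free_tuple multilinear_relb
    multilinear_rel_submod.

Definition tpow := Quotient.quot (multilinear_relb : zmodClosed _).
HB.instance Definition _ := GRing.Zmodule.on tpow.
HB.instance Definition _ := EqQuotient.on tpow.

Definition tpow_pi (x : free_tuple) : tpow := (\pi_tpow x)%qT.

Lemma tpow_piE x y : tpow_pi x = tpow_pi y <-> lspan multilinear_rel (x - y).
Proof.
rewrite /tpow_pi; split=> [/eqP|h].
  by rewrite -[_ == _]Quotient.idealrBE => /asboolP.
by apply/eqP; rewrite -[_ == _]Quotient.idealrBE; apply/asboolP.
Qed.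

Lemma tpow_pi_surj (x : tpow) : exists y, tpow_pi y = x.
Proof. by exists (generic_quotient.repr x); rewrite /tpow_pi reprK. Qed.

Lemma tpow_piB : {morph tpow_pi : x y / x - y}.
Proof. by move=> x y; rewrite /tpow_pi raddfB. Qed.
Lemma tpow_piD : {morph tpow_pi : x y / x + y}.
Proof. by move=> x y; rewrite /tpow_pi raddfD. Qed.

Definition tpow_scale (c : R) (x : tpow) : tpow :=
  tpow_pi (c *: generic_quotient.repr x).

Fact tpow_scale_pi c x : tpow_scale c (tpow_pi x) = tpow_pi (c *: x).
Proof.
apply/tpow_piE; rewrite -scalerBr -[_ *: _]addr0; apply: lspan_submod.
  by apply/tpow_piE; rewrite /tpow_pi reprK.
exact: lspan0.
Qed.

Fact tpow_scaleA a b x : tpow_scale a (tpow_scale b x) = tpow_scale (a * b) x.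
Proof. by have [y <-] := tpow_pi_surj x; rewrite !tpow_scale_pi scalerA. Qed.
Fact tpow_scale1 : left_id 1 tpow_scale.
Proof.
by move=> x; have [y <-] := tpow_pi_surj x; rewrite tpow_scale_pi scale1r.
Qed.
Fact tpow_scaleDr : right_distributive tpow_scale +%R.
Proof.
move=> c x y; have [u <-] := tpow_pi_surj x; have [v <-] := tpow_pi_surj y.
by rewrite -tpow_piD !tpow_scale_pi scalerDr tpow_piD.
Qed.
Fact tpow_scaleDl x : {morph tpow_scale^~ x : a b / a + b}.
Proof.
move=> a b; have [u <-] := tpow_pi_surj x.
by rewrite !tpow_scale_pi scalerDl tpow_piD.
Qed.
HB.instance Definition _ :=
  GRing.Zmodule_isLmodule.Build R tpow
    tpow_scaleA tpow_scale1 tpow_scaleDr tpow_scaleDl.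

Fact tpow_pi_linear : linear tpow_pi.
Proof. by move=> c x y; rewrite tpow_piD -tpow_scale_pi. Qed.
HB.instance Definition _ :=
  GRing.isLinear.Build R free_tuple tpow *:%R tpow_pi tpow_pi_linear.

Definition tprod (t : n.-tuple A) : tpow := tpow_pi (free_gen t).

Lemma tprod_multilinear (i : 'I_n) c (t t1 t2 : n.-tuple A) :
  tnth t i = c *: tnth t1 i + tnth t2 i ->
  (forall j, j != i -> tnth t1 j = tnth t j /\ tnth t2 j = tnth t j) ->
  tprod t = c *: tprod t1 + tprod t2.
Proof.
move=> h1 h2; rewrite -linearP; apply/tpow_piE.
rewrite -[X in lspan _ X]addr0 -[X in lspan _ (X + _)]scale1r.
by apply: lspan_step; [exists i, c, t, t1, t2 | exact: lspan0].
Qed.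

Lemma tprod_span (x : tpow) : lspan (fun y => exists t, y = tprod t) x.
Proof.
have [y <-] := tpow_pi_surj x; rewrite (dsum_decomp y) linear_sum.
elim/big_rec: _ => [|t u _ hu]; first exact: lspan0.
rewrite [X in lspan _ (X + _)](_ : _ = y t *: tprod t).
  by apply: lspan_step => //; exists t.
rewrite -linearZ; congr tpow_pi; apply: dsumP => j.
have [<-|ne] := eqVneq t j; last first.
  by rewrite dsum_funZ !dsum_in_neq // scaler0.
by rewrite dsum_funZ !dsum_in_id /GRing.scale /= mulr1.
Qed.

Lemma tpow_lift (N : lmodType R) (f : n.-tuple A -> N) :
  (forall (i : 'I_n) c (t t1 t2 : n.-tuple A),
     tnth t i = c *: tnth t1 i + tnth t2 i ->
     (forall j, j != i -> tnth t1 j = tnth t j /\ tnth t2 j = tnth t j) ->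
     f t = c *: f t1 + f t2) ->
  exists L : {linear tpow -> N}, forall t, L (tprod t) = f t.
Proof.
move=> fm.
have hlin t : linear (fun c : R^o => c *: f t).
  by move=> a b c /=; rewrite scalerDl scalerA.
pose hm t := GRing.isLinear.Build R R^o N *:%R _ (hlin t).
pose h t : {linear R^o -> N} := HB.pack (fun c : R^o => c *: f t) (hm t).
have [L LE] := dsum_lift h.
have LG t : L (free_gen t) = f t.
  by rewrite LE /= scale1r.
have L0 x : lspan multilinear_rel x -> L x = 0.
  elim=> [|c u v [i [d [t [t1 [t2 [h1 h2 ->]]]]]] _ IH]; first exact: linear0.
  rewrite linearP IH addr0 linearB linearP !LG -(fm i d t t1 t2 h1 h2).
  by rewrite subrr scaler0.
pose G (x : tpow) := L (generic_quotient.repr x).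
have GE x : G (tpow_pi x) = L x.
  apply/eqP; rewrite -subr_eq0 -linearB; apply/eqP/L0/tpow_piE.
  by rewrite /tpow_pi reprK.
have Glin : linear G.
  move=> c x y; have [u <-] := tpow_pi_surj x; have [v <-] := tpow_pi_surj y.
  by rewrite -linearP !GE linearP.
pose Gm := GRing.isLinear.Build R tpow N *:%R G Glin.
pose GG : {linear tpow -> N} := HB.pack G Gm.
by exists GG => t; change (G (tprod t) = f t); rewrite GE LG.
Qed.
End TensorPower.

Section LspanTheory.
Variables (R : pzRingType) (V : lmodType R).
Implicit Types G : V -> Prop.

Lemma lspan_gen G x : G x -> lspan G x.
Proof.
by move=> Gx; rewrite -[x]addr0 -[x]scale1r; apply: lspan_step; last exact: lspan0.
Qed.

Lemma lspan_trans G H x : (forall y, G y -> lspan H y) -> lspan G x -> lspan H x.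
Proof.
move=> GH; elim=> [|c y z /GH Hy _ Hz]; first exact: lspan0.
exact: lspan_submod.
Qed.

Lemma lspan_eq (N : lmodType R) G (f g : {linear V -> N}) x :
  (forall y, G y -> f y = g y) -> lspan G x -> f x = g x.
Proof.
by move=> fg; elim=> [|c y z /fg Ey _ Ez]; rewrite ?linear0 // !linearP Ey Ez.
Qed.
End LspanTheory.

(* H i is the submodule of elements of degree i, and V is the (internal) direct
   sum of the H i, for i in int. *)
Definition is_grading (R : pzRingType) (V : lmodType R) (H : int -> V -> Prop) :=
  [/\ forall i, H i 0 /\ forall c x y, H i x -> H i y -> H i (c *: x + y),
      forall v, exists (s : seq int) (x : int -> V),
        [/\ uniq s, forall i, H i (x i) & v = \sum_(i <- s) x i]
    & forall (s : seq int) (x : int -> V),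
        uniq s -> (forall i, H i (x i)) -> \sum_(i <- s) x i = 0 ->
        forall i, i \in s -> x i = 0].

Structure gradedModule (R : pzRingType) := GradedModule {
  graded_sort :> lmodType R;
  homog : int -> graded_sort -> Prop;
  homogP : is_grading homog
}.

Section Components.
Variables (R : pzRingType) (A : gradedModule R).
Implicit Types a : A.

Lemma homog0 i : homog i (0 : A).
Proof. by have [h _ _] := homogP A; case: (h i). Qed.
Lemma homogL i c a b : homog i a -> homog i b -> homog i (c *: a + b).
Proof. by have [h _ _] := homogP A; case: (h i) => _; apply. Qed.

Lemma homog_dec a : exists p : seq int * (int -> A),
  [/\ uniq p.1, forall i, homog i (p.2 i), forall i, i \notin p.1 -> p.2 i = 0
    & a = \sum_(i <- p.1) p.2 i].
Proof.
have [_ h _] := homogP A; have [s [x [us hx ->]]] := h a.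
exists (s, fun i => if i \in s then x i else 0); split=> //=.
- by move=> i; case: ifP => // _; exact: homog0.
- by move=> i /negbTE ->.
- by rewrite big_seq [RHS]big_seq; apply: eq_bigr => i ->.
Qed.

Definition gsupp a : seq int := (projT1 (cid (homog_dec a))).1.
Definition gcomp a : int -> A := (projT1 (cid (homog_dec a))).2.

Lemma gcompP a : [/\ uniq (gsupp a), forall i, homog i (gcomp a i),
  forall i, i \notin gsupp a -> gcomp a i = 0 & a = \sum_(i <- gsupp a) gcomp a i].
Proof. exact: (projT2 (cid (homog_dec a))). Qed.

Lemma big_supp (N : lmodType R) a (S : seq int) (h : int -> N) :
  uniq S -> {subset gsupp a <= S} -> (forall i, i \notin gsupp a -> h i = 0) ->
  \sum_(i <- gsupp a) h i = \sum_(i <- S) h i.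
Proof.
move=> uS sub h0; have [us _ _ _] := gcompP a.
rewrite [RHS](bigID (mem (gsupp a))) /= [X in _ = _ + X]big1 ?addr0; last first.
  by move=> i; exact: h0.
rewrite -[RHS]big_filter; apply: perm_big; apply: uniq_perm.
- by [].
- exact: filter_uniq.
by move=> i; rewrite mem_filter; case: (boolP (i \in gsupp a)) => //= /sub ->.
Qed.

Lemma gcomp_uniq a (s : seq int) (x : int -> A) : uniq s ->
  (forall i, homog i (x i)) -> (forall i, i \notin s -> x i = 0) ->
  a = \sum_(i <- s) x i -> gcomp a =1 x.
Proof.
move=> us hx x0 ea; have [ug hg g0 eg] := gcompP a.
pose S := undup (gsupp a ++ s).
have uS : uniq S by exact: undup_uniq.
have eg' : a = \sum_(i <- S) gcomp a i.
  rewrite {1}eg; apply: big_supp => // i hi.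
  by rewrite mem_undup mem_cat hi.
have ex' : a = \sum_(i <- S) x i.
  rewrite ea [RHS](bigID (mem s)) /= [X in _ = _ + X]big1 ?addr0; last first.
    by move=> i; exact: x0.
  rewrite -[RHS]big_filter; apply: perm_big; apply: uniq_perm => //.
    exact: filter_uniq.
  move=> i; rewrite mem_filter mem_undup mem_cat.
  by case: (i \in s); rewrite ?orbT.
have [_ _ ind] := homogP A.
have e0 : \sum_(i <- S) ((-1) *: x i + gcomp a i) = 0.
  by rewrite big_split /= -scaler_sumr -ex' -eg' scaleN1r addNr.
have hS i : homog i ((-1) *: x i + gcomp a i) by exact: homogL.
move=> i; have [iS|] := boolP (i \in S).
  have /eqP := ind _ _ uS hS e0 i iS.
  by rewrite scaleN1r addrC subr_eq0 => /eqP.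
by rewrite mem_undup mem_cat negb_or => /andP[/g0 -> /x0 ->].
Qed.

Lemma gcomp_linear c a b i : gcomp (c *: a + b) i = c *: gcomp a i + gcomp b i.
Proof.
have [ua ha a0 ea] := gcompP a; have [ub hb b0 eb] := gcompP b.
pose S := undup (gsupp a ++ gsupp b).
apply: (@gcomp_uniq _ S (fun i => c *: gcomp a i + gcomp b i)).
- exact: undup_uniq.
- by move=> j; exact: homogL.
- move=> j; rewrite mem_undup mem_cat negb_or => /andP[/a0 -> /b0 ->].
  by rewrite scaler0 addr0.
- rewrite big_split /= -scaler_sumr -(@big_supp _ a S (gcomp a)) //; first last.
  - by move=> j hj; rewrite mem_undup mem_cat hj.
  - exact: undup_uniq.
  rewrite -(@big_supp _ b S (gcomp b)) -?ea -?eb //; first exact: undup_uniq.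
  by move=> j hj; rewrite mem_undup mem_cat hj orbT.
Qed.

Lemma gcomp_homog d a i : homog d a -> gcomp a i = if i == d then a else 0.
Proof.
move=> ha; apply: (@gcomp_uniq _ [:: d] (fun i => if i == d then a else 0)) => //.
- by move=> j; case: eqP => [->|_] //; exact: homog0.
- by move=> j; rewrite inE => /negbTE ->.
- by rewrite big_seq1 eqxx.
Qed.
End Components.

Section TensorAlgebra.
Variables (R : comPzRingType) (A : gradedModule R).
Implicit Types (a b : A) (s t : seq A) (d e : int) (ds es : seq int).

(* The graded structure on tens is TA, at the end of this section. *)
Definition tens : lmodType R := dsum (tpow A).

Definition word s : tens := dsum_in (tprod (in_tuple s)).

Lemma wordE n (t : n.-tuple A) : word t = dsum_in (tprod t).
Proof.
case: t => s e /=; have e' := eqP e; subst n.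
by rewrite /word; congr (dsum_in (tprod _)); apply: val_inj.
Qed.

Lemma word_span (x : tens) : lspan (fun y => exists s, y = word s) x.
Proof.
rewrite (dsum_decomp x); elim/big_rec: _ => [|n u _ hu]; first exact: lspan0.
rewrite -[dsum_in _]scale1r; apply: lspan_submod => //.
elim: (tprod_span (x n)) => [|c y z [t ->] _ IH].
  by rewrite linear0; exact: lspan0.
by rewrite linearP; apply: lspan_step => //; exists t; rewrite wordE.
Qed.

(* s, s1, s2 agree except at position p, where s is c times s1 plus s2. *)
Definition slot (c : R) (p : nat) s s1 s2 :=
  [/\ (p < size s)%N, size s1 = size s, size s2 = size s,
      s`_p = c *: s1`_p + s2`_p &
      forall q, q != p -> s1`_q = s`_q /\ s2`_q = s`_q].

Lemma word_slot c p s s1 s2 :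
  slot c p s s1 s2 -> word s = c *: word s1 + word s2.
Proof.
case=> ps e1 e2 ep eq.
pose t1 := tcast e1 (in_tuple s1); pose t2 := tcast e2 (in_tuple s2).
have -> : word s1 = dsum_in (tprod t1) by rewrite -wordE val_tcast.
have -> : word s2 = dsum_in (tprod t2) by rewrite -wordE val_tcast.
rewrite -linearP; congr dsum_in.
apply: (@tprod_multilinear _ _ _ (Ordinal ps)).
  by rewrite !(tnth_nth 0) !val_tcast.
move=> j nj; rewrite !(tnth_nth 0) !val_tcast /=; apply: eq.
by rewrite -val_eqE in nj.
Qed.

Lemma tens_lift (N : lmodType R) (f : seq A -> N) :
  (forall c p s s1 s2, slot c p s s1 s2 -> f s = c *: f s1 + f s2) ->
  exists L : {linear tens -> N}, forall s, L (word s) = f s.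
Proof.
move=> fm.
have ex n : exists L : {linear tpow A n -> N},
      forall t : n.-tuple A, L (tprod t) = f t.
  apply: (tpow_lift (f := fun t : n.-tuple A => f t)) => i c t t1 t2 h1 h2.
  apply: (fm c i); split; rewrite ?size_tuple //; first by rewrite -!tnth_nth.
  move=> q nq; have [qn|nq'] := ltnP q n; last by rewrite !nth_default ?size_tuple.
  have := h2 (Ordinal qn); rewrite -val_eqE => /(_ nq).
  by rewrite !(tnth_nth 0).
have [L LE] := dsum_lift (fun n => projT1 (cid (ex n))).
exists L => s; rewrite LE; exact: (projT2 (cid (ex (size s)))).
Qed.

(* ds lists degrees of the letters of s (not unique: 0 has every degree). *)
Fixpoint homogs ds s : Prop :=
  match ds, s with
  | [::], [::] => True
  | d :: ds', a :: s' => homog d a /\ homogs ds' s'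
  | _, _ => False
  end.

Lemma homogs_size ds s : homogs ds s -> size ds = size s.
Proof. by elim: ds s => [|d ds IH] [|a s] //= [_ /IH ->]. Qed.

Lemma homogs_cat ds es s t : homogs ds s -> homogs es t -> homogs (ds ++ es) (s ++ t).
Proof. by elim: ds s => [|d ds IH] [|a s] //= [ha /IH h] /h. Qed.

(* A family f ds s, multilinear in s for each list of degrees ds, extends to a
   linear map on TA with value f ds s on words s with letters of degrees ds. *)
Section HomogeneousLift.
Variable N : lmodType R.
Implicit Types f : seq int -> seq A -> N.

Fixpoint hlift f s : N :=
  if s is a :: s' then
    \sum_(i <- gsupp a) hlift (fun ds u => f (i :: ds) (gcomp a i :: u)) s'
  else f [::] [::].

Definition hmulti f := forall ds c p s s1 s2,
  size ds = size s -> slot c p s s1 s2 -> f ds s = c *: f ds s1 + f ds s2.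

Lemma hlift_lin f f1 f2 c s :
  (forall ds u, size ds = size u -> f ds u = c *: f1 ds u + f2 ds u) ->
  hlift f s = c *: hlift f1 s + hlift f2 s.
Proof.
elim: s f f1 f2 => [|a s IH] f f1 f2 h /=; first exact: h.
rewrite scaler_sumr -big_split; apply: eq_bigr => i _ /=.
by apply: IH => ds u e; apply: h; rewrite /= e.
Qed.

Lemma hlift0 f s :
  (forall ds u, size ds = size u -> f ds u = 0) -> hlift f s = 0.
Proof.
move=> h; have := @hlift_lin f f f (-1) s; rewrite scaleN1r addNr; apply.
by move=> ds u /h ->; rewrite scaleN1r addNr.
Qed.

Lemma hmulti_cons f i a : hmulti f -> hmulti (fun ds u => f (i :: ds) (a :: u)).
Proof.
move=> fm ds c p s s1 s2 e [ps e1 e2 ep eq]; apply: (fm _ c p.+1).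
  by rewrite /= e.
split; rewrite /= ?e1 ?e2 //; by case.
Qed.

Lemma hmulti_head f i c a1 a2 ds u : hmulti f -> size ds = size u ->
  f (i :: ds) ((c *: a1 + a2) :: u) =
  c *: f (i :: ds) (a1 :: u) + f (i :: ds) (a2 :: u).
Proof.
move=> fm e; apply: (fm _ c 0%N); first by rewrite /= e.
by split=> //; case.
Qed.

Lemma hmulti_head0 f i ds u : hmulti f -> size ds = size u ->
  f (i :: ds) (0 :: u) = 0.
Proof.
move=> fm e; have := @hmulti_head f i (-1) 0 0 ds u fm e.
by rewrite scaler0 addr0 scaleN1r addNr.
Qed.

Lemma hlift_multi f : hmulti f ->
  forall c p s s1 s2, slot c p s s1 s2 ->
  hlift f s = c *: hlift f s1 + hlift f s2.
Proof.
move=> fm c p s; elim: s f fm p => [|a s IH] f fm p s1 s2 [] //.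
case: s1 s2 => [|a1 s1] [|a2 s2] //; case: p => [|p] ps [e1] [e2] /= ep eq.
  have E1 : s1 = s.
    by apply: (@eq_from_nth _ 0) => // q _; have [] := eq q.+1 isT.
  have E2 : s2 = s.
    by apply: (@eq_from_nth _ 0) => // q _; have [] := eq q.+1 isT.
  rewrite {}E1 {}E2 {ps e1 e2 eq}.
  pose G i b := hlift (fun ds u => f (i :: ds) (b :: u)) s.
  have G0 i : G i 0 = 0 by apply: hlift0 => ds u /hmulti_head0; apply.
  pose S := undup (gsupp a ++ gsupp a1 ++ gsupp a2).
  have GS b : {subset gsupp b <= S} ->
      \sum_(i <- gsupp b) G i (gcomp b i) = \sum_(i <- S) G i (gcomp b i).
    move=> sb; apply: big_supp => //; first exact: undup_uniq.
    by move=> i hi; have [_ _ h _] := gcompP b; rewrite h // G0.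
  rewrite -/(\sum_(i <- gsupp a) G i (gcomp a i)).
  rewrite -/(\sum_(i <- gsupp a1) G i (gcomp a1 i)).
  rewrite -/(\sum_(i <- gsupp a2) G i (gcomp a2 i)).
  rewrite !GS; last 3 first.
  - by move=> i hi; rewrite mem_undup !mem_cat hi !orbT.
  - by move=> i hi; rewrite mem_undup !mem_cat hi orbT.
  - by move=> i hi; rewrite mem_undup !mem_cat hi.
  rewrite scaler_sumr -big_split; apply: eq_bigr => i _ /=.
  rewrite ep gcomp_linear; apply: hlift_lin => ds u e.
  exact: hmulti_head.
have [/= E1 E2] := eq 0%N isT; rewrite {}E1 {}E2.
rewrite scaler_sumr -big_split; apply: eq_bigr => i _ /=.
apply: (IH _ _ p); first exact: hmulti_cons.
by split=> // q nq; have := eq q.+1; apply.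
Qed.

Lemma hlift_homogs f ds s : hmulti f -> homogs ds s -> hlift f s = f ds s.
Proof.
elim: s f ds => [|a s IH] f [|d ds] //= fm [ha hs].
have [us _ g0 _] := gcompP a.
have E i : hlift (fun ds u => f (i :: ds) (gcomp a i :: u)) s =
    if i == d then f (d :: ds) (a :: s) else 0.
  rewrite (gcomp_homog i ha); case: eqP => [->|_].
    by rewrite (IH _ ds) //; exact: hmulti_cons.
  by apply: hlift0 => es u /hmulti_head0; apply.
rewrite (eq_bigr (fun i => if i == d then f (d :: ds) (a :: s) else 0)) //.
have [ds'|nd] := boolP (d \in gsupp a).
  rewrite (bigD1_seq d) //= eqxx big1 ?addr0 // => i /negbTE -> //.
have a0 : a = 0 by have := g0 d nd; rewrite (gcomp_homog d ha) eqxx.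
rewrite a0 hmulti_head0 ?big1 //; first by move=> i _; case: ifP.
exact: homogs_size.
Qed.

Lemma tens_hlift f : hmulti f ->
  exists L : {linear tens -> N}, forall ds s, homogs ds s -> L (word s) = f ds s.
Proof.
move=> fm; have [L LE] := tens_lift (hlift_multi fm).
by exists L => ds s hs; rewrite LE (hlift_homogs fm hs).
Qed.
End HomogeneousLift.

Lemma hword_span (x : tens) :
  lspan (fun y => exists ds s, homogs ds s /\ y = word s) x.
Proof.
pose G y := exists ds s, homogs ds s /\ y = word s.
apply: lspan_trans (word_span x) => _ [s ->] {x}.
suff: forall t es, homogs es t -> lspan G (word (t ++ s)).
  by move=> /(_ [::] [::] I).
elim: s => [|a s IH] t es ht.
  by rewrite cats0; apply: lspan_gen; exists es, t.
have [_ hg _ ->] := gcompP a.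
have lin : linear (fun b => word (t ++ b :: s)).
  move=> c b1 b2; apply: (@word_slot c (size t)); split.
  - by rewrite size_cat /= addnS ltnS leq_addr.
  - by rewrite !size_cat.
  - by rewrite !size_cat.
  - by rewrite !nth_cat ltnn subnn.
  - move=> q nq; rewrite !nth_cat; case: ltnP => // le.
    case E: (q - size t)%N => [|k] //=.
    by move: nq; rewrite eqn_leq le -subn_eq0 E.
pose Lm := GRing.isLinear.Build R A tens *:%R _ lin.
pose L : {linear A -> tens} := HB.pack (fun b => word (t ++ b :: s)) Lm.
change (lspan G (L (\sum_(i <- gsupp a) gcomp a i))).
rewrite linear_sum; elim/big_rec: _ => [|i x _ hx]; first exact: lspan0.
rewrite -[L _]scale1r; apply: lspan_submod => //.
change (lspan G (word (t ++ gcomp a i :: s))).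
rewrite -cat_rcons; apply: (IH _ (es ++ [:: i])).
by rewrite -cats1; apply: homogs_cat.
Qed.

(* The word a_1 ... a_n has degree |a_1| + ... + |a_n| + n. *)
Definition tens_deg (e : int) (x : tens) : Prop :=
  lspan (fun y => exists ds s,
    [/\ homogs ds s, \sum_(d <- ds) d + (size s)%:Z = e & y = word s]) x.

Lemma tens_deg_proj e : exists P : {linear tens -> tens},
  forall d x, tens_deg d x -> P x = if d == e then x else 0.
Proof.
pose f ds s := if \sum_(d <- ds) d + (size s)%:Z == e then word s else 0.
have fm : hmulti f.
  move=> ds c p s s1 s2 _ sl; rewrite /f; have [_ -> -> _ _] := sl.
  by case: ifP => _; [exact: (word_slot sl) | rewrite scaler0 addr0].
have [P PE] := tens_hlift fm; exists P => d x.
elim=> [|c y z [ds [s [hs <- ->]]] _ IH]; first by rewrite linear0; case: ifP.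
rewrite linearP IH (PE _ _ hs) /f.
by case: ifP => // _; rewrite scaler0 addr0.
Qed.

Fact tens_grading : is_grading tens_deg.
Proof.
pose P e := projT1 (cid (tens_deg_proj e)).
have PE e d x : tens_deg d x -> P e x = if d == e then x else 0.
  exact: (projT2 (cid (tens_deg_proj e))).
split.
- by move=> i; split=> [|c x y]; [exact: lspan0 | exact: lspan_submod].
- move=> v.
  suff [s [us [hP h0 hv]]] : exists s : seq int, uniq s /\
      [/\ forall i, tens_deg i (P i v), forall i, i \notin s -> P i v = 0
        & v = \sum_(i <- s) P i v].
    by exists s, (P^~ v).
  elim: (hword_span v) => [|c y z [ds [s [hs ->]]] _ [S [uS [hP h0 hz]]]].
    exists [::]; split=> //; split; last by rewrite big_nil.
      by move=> i; rewrite linear0; exact: lspan0.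
    by move=> i _; rewrite linear0.
  set w := word s; set e := \sum_(d <- ds) d + (size s)%:Z.
  have hw : tens_deg e w by apply: lspan_gen; exists ds, s.
  have Pw i := PE i _ _ hw.
  exists (undup (e :: S)); split; first exact: undup_uniq.
  split.
  - move=> i; rewrite linearP Pw; apply: lspan_submod; last exact: hP.
    by case: eqP => [<-|_]; [exact: hw | exact: lspan0].
  - move=> i; rewrite mem_undup inE negb_or eq_sym => /andP[/negbTE ne /h0 z0].
    by rewrite linearP Pw ne z0 scaler0 addr0.
  have -> : \sum_(i <- undup (e :: S)) P i (c *: w + z) =
      \sum_(i <- undup (e :: S)) (c *: P i w) + \sum_(i <- undup (e :: S)) P i z.
    by rewrite -big_split; apply: eq_bigr => i _; rewrite linearP.
  congr (_ + _).
    rewrite -scaler_sumr (bigD1_seq e) ?undup_uniq ?mem_undup ?mem_head //=.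
    rewrite Pw eqxx big1 ?addr0 // => i ne.
    by rewrite Pw eq_sym (negbTE ne).
  rewrite {1}hz [RHS](bigID (mem S)) /= [X in _ = _ + X]big1 ?addr0; last first.
    by move=> i; exact: h0.
  rewrite -[RHS]big_filter; apply: perm_big; apply: uniq_perm => //.
    by apply: filter_uniq; exact: (undup_uniq (e :: S)).
  move=> i; rewrite mem_filter (mem_undup (e :: S)) inE.
  by case: (i \in S); rewrite ?orbT.
- move=> s x us hx s0 j js.
  have := linear0 (P j); rewrite -s0 linear_sum (bigD1_seq j) //=.
  rewrite (PE _ _ _ (hx j)) eqxx big1 ?addr0 // => i ne.
  by rewrite (PE _ _ _ (hx i)) (negbTE ne).
Qed.

Definition TA : gradedModule R := GradedModule tens_grading.
End TensorAlgebra.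

(* (-1)^k for an integer k; only the parity of k matters, so |k| is used. *)
Definition ksign (R : pzRingType) (k : int) : R := (-1) ^+ `|k|%N.

Section Shuffle.
Variables (R : comPzRingType) (A : gradedModule R).

(* (n, m)-shuffles, with 0-based indices: sigma is increasing on the first n and
   on the last m indices. *)
Definition is_shuffle n m (sigma : 'S_(n + m)) : bool :=
  [forall i : 'I_(n + m), forall j : 'I_(n + m),
     (i < j)%N && ((j < n)%N || (n <= i)%N) ==> (sigma i < sigma j)%N].

Definition shuffle_exponent (N : nat) (ds : seq int) (sigma : 'S_N) : int :=
  \sum_(p : 'I_N * 'I_N | (p.1 < p.2)%N && (sigma p.2 < sigma p.1)%N)
     (ds`_p.1 + 1) * (ds`_p.2 + 1).

Definition shuffle_sum n m (ds : seq int) (s : seq A) : TA A :=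
  \sum_(sigma : 'S_(n + m) | is_shuffle sigma)
     ksign R (shuffle_exponent ds sigma) *:
       word [seq s`_((sigma^-1)%g i) | i : 'I_(n + m)].

(* The formula is prescribed on words with homogeneous letters only; together
   with bilinearity this determines the product (shuffle_exists,
   shuffle_unique). *)
Definition is_shuffle_product (mul : TA A -> TA A -> TA A) : Prop :=
  [/\ forall y, linear (mul^~ y), forall x, linear (mul x)
    & forall ds es s t, homogs ds s -> homogs es t ->
        mul (word s) (word t) =
          shuffle_sum (size s) (size t) (ds ++ es) (s ++ t)].

Lemma slot_perm c p s s1 s2 N (sigma : 'S_N) :
  size s = N -> slot (A := A) c p s s1 s2 ->
  exists q, slot c q [seq s`_((sigma^-1)%g i) | i : 'I_N]
    [seq s1`_((sigma^-1)%g i) | i : 'I_N] [seq s2`_((sigma^-1)%g i) | i : 'I_N].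
Proof.
move=> eN [ps e1 e2 ep eq]; rewrite eN in ps.
have nE (u : seq A) (i : 'I_N) : [seq u`_((sigma^-1)%g i) | i : 'I_N]`_i
    = u`_((sigma^-1)%g i).
  by rewrite (nth_map i) ?nth_ord_enum // size_enum_ord.
have sz (u : seq A) : size [seq u`_((sigma^-1)%g i) | i : 'I_N] = N.
  by rewrite size_map size_enum_ord.
exists (sigma (Ordinal ps)); split; rewrite ?sz //.
  by rewrite !nE permK.
move=> q nq; have [qN|qN] := ltnP q N; last by rewrite !nth_default ?sz.
rewrite -[q]/(nat_of_ord (Ordinal qN)) !nE; apply: eq.
apply: contraNneq nq => e; apply/eqP.
have /(congr1 sigma) : (sigma^-1)%g (Ordinal qN) = Ordinal ps by apply: val_inj.
by rewrite permKV => <-.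
Qed.

Lemma shuffle_sum_slot n m ds c p s s1 s2 :
  size s = (n + m)%N -> slot c p s s1 s2 ->
  shuffle_sum n m ds s = c *: shuffle_sum n m ds s1 + shuffle_sum n m ds s2.
Proof.
move=> e sl; rewrite scaler_sumr -big_split; apply: eq_bigr => sigma _ /=.
have [q /word_slot ->] := slot_perm sigma e sl.
by rewrite scalerDr !scalerA mulrC.
Qed.

Lemma slot_catl c p (s s1 s2 t : seq A) :
  slot c p s s1 s2 -> slot c p (s ++ t) (s1 ++ t) (s2 ++ t).
Proof.
case=> ps e1 e2 ep eq; split; rewrite ?size_cat ?e1 ?e2 //.
- exact: leq_trans (leq_addr _ _).
- by rewrite !nth_cat e1 e2 ps.
- by move=> q nq; rewrite !nth_cat e1 e2; case: ifP => // _; exact: eq.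
Qed.

Lemma slot_catr c p (t s s1 s2 : seq A) :
  slot c p s s1 s2 -> slot c (size t + p) (t ++ s) (t ++ s1) (t ++ s2).
Proof.
case=> ps e1 e2 ep eq; split; rewrite ?size_cat ?e1 ?e2 ?ltn_add2l //.
- by rewrite !nth_cat ltnNge leq_addr addKn.
- move=> q nq; rewrite !nth_cat; case: ltnP => // le; apply: eq.
  by apply: contraNneq nq => <-; rewrite subnKC.
Qed.

Lemma shuffle_exists : exists mul, is_shuffle_product mul.
Proof.
have step ds s : size ds = size s ->
    exists L : {linear tens A -> tens A}, forall es t, homogs es t ->
      L (word t) = shuffle_sum (size ds) (size es) (ds ++ es) (s ++ t).
  move=> e; apply: tens_hlift (fun es t =>
    shuffle_sum (size ds) (size es) (ds ++ es) (s ++ t)) _ => es c p t t1 t2 e' sl.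
  apply: shuffle_sum_slot; first by rewrite size_cat e e'.
  exact: slot_catr sl.
have {}step ds s : exists L : {linear tens A -> tens A}, size ds = size s ->
    forall es t, homogs es t ->
      L (word t) = shuffle_sum (size ds) (size es) (ds ++ es) (s ++ t).
  have [e|ne] := eqVneq (size ds) (size s).
    by have [L LE] := step ds s e; exists L.
  by exists idfun => e; rewrite e eqxx in ne.
pose L ds s := projT1 (cid (step ds s)).
have LE ds s : size ds = size s -> forall es t, homogs es t ->
    L ds s (word t) = shuffle_sum (size ds) (size es) (ds ++ es) (s ++ t).
  exact: (projT2 (cid (step ds s))).
have Lm y : hmulti (fun ds s => L ds s y).
  move=> ds c p s s1 s2 e sl; have [_ e1 e2 _ _] := sl.
  elim: (hword_span y) => [|b u z [es [t [ht ->]]] _ IH].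
    by rewrite !linear0 ?scaler0 addr0.
  rewrite !linearP IH (LE ds s e es t ht) (LE ds s1 (etrans e (esym e1)) es t ht).
  rewrite (LE ds s2 (etrans e (esym e2)) es t ht).
  have sz : size (s ++ t) = (size ds + size es)%N.
    by rewrite size_cat e (homogs_size ht).
  rewrite (shuffle_sum_slot _ sz (slot_catl t sl)).
  by rewrite !scalerDr !scalerA [b * c]mulrC addrACA.
have Mex y := tens_hlift (Lm y).
pose M y := projT1 (cid (Mex y)).
have ME y ds s : homogs ds s -> M y (word s) = L ds s y.
  exact: (projT2 (cid (Mex y)) ds s).
exists (fun x y => M y x); split.
- by move=> y c u v; rewrite linearP.
- move=> x c u v; elim: (hword_span x) => [|b y z [ds [s [hs ->]]] _ IH].
    by rewrite !linear0 ?scaler0 addr0.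
  rewrite !linearP IH !(ME _ _ _ hs) linearP.
  by rewrite !scalerDr !scalerA [b * c]mulrC addrACA.
- move=> ds es s t hs ht; rewrite (ME _ _ _ hs) (LE ds s (homogs_size hs) es t ht).
  by rewrite (homogs_size hs) (homogs_size ht).
Qed.

Definition shuffle : TA A -> TA A -> TA A := projT1 (cid shuffle_exists).

Lemma shuffleP : is_shuffle_product shuffle.
Proof. exact: (projT2 (cid shuffle_exists)). Qed.

Lemma shuffle_unique mul : is_shuffle_product mul -> mul = shuffle.
Proof.
case=> l1 r1 E1; have [l2 r2 E2] := shuffleP.
apply/funext => x; apply/funext => y.
have add2 (V W : lmodType R) (h : V -> W) : linear h ->
    forall c u v, h (c *: u + v) = c *: h u + h v by [].
have zero2 (V W : lmodType R) (h : V -> W) : linear h -> h 0 = 0.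
  by move=> hl; have := hl (-1) 0 0; rewrite scaler0 addr0 scaleN1r addNr.
elim: (hword_span x) => [|b u z [ds [s [hs ->]]] _ IHx].
  by rewrite (zero2 _ _ _ (l1 y)) (zero2 _ _ _ (l2 y)).
rewrite (add2 _ _ _ (l1 y)) (add2 _ _ _ (l2 y)) IHx; congr (_ *: _ + _).
elim: (hword_span y) => [|b' u' z' [es [t [ht ->]]] _ IHy].
  by rewrite (zero2 _ _ _ (r1 _)) (zero2 _ _ _ (r2 _)).
by rewrite r1 r2 IHy (E1 _ _ _ _ hs ht) (E2 _ _ _ _ hs ht).
Qed.
End Shuffle.

Section Coderivation.
Variables (R : comPzRingType) (A : gradedModule R).
Variables (k : nat) (mu : {linear tpow A k -> A}).

(* coder is the lift Delta_{3-2k} of mu = mu_k to a coderivation of TA for the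
   deconcatenation coproduct, given by its explicit formula. The index i is
   0-based; the range of coder_sum is empty on words of length < k. *)
Definition coder_exponent (i : nat) (ds : seq int) : int :=
  \sum_(0 <= l < i) (ds`_l + 1) +
  \sum_(0 <= l < k) (k - l.+1)%:Z * ds`_(i + l).

Definition coder_sum (ds : seq int) (s : seq A) : TA A :=
  \sum_(0 <= i < (size s).+1 - k)
     ksign R (coder_exponent i ds) *:
       word (take i s ++ mu (tprod [tuple s`_(i + l) | l < k]) :: drop (i + k) s).

Definition is_coder (D : {linear TA A -> TA A}) : Prop :=
  forall ds s, homogs ds s -> D (word s) = coder_sum ds s.

Lemma coder_sum_slot ds c p s s1 s2 : slot c p s s1 s2 ->
  coder_sum ds s = c *: coder_sum ds s1 + coder_sum ds s2.
Proof.
move=> [ps e1 e2 ep eq]; rewrite /coder_sum e1 e2 scaler_sumr -big_split.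
apply: eq_big_nat => i /= hi.
rewrite !scalerA [c * _]mulrC -scalerA -scalerDr; congr (_ *: _).
have le_ik : (i + k <= size s)%N by lia.
pose W u := take i u ++ mu (tprod [tuple u`_(i + l) | l < k]) :: drop (i + k) u.
rewrite -[take i s ++ _]/(W s) -[take i s1 ++ _]/(W s1) -[take i s2 ++ _]/(W s2).
have szW u : size u = size s -> size (W u) = (size s - k).+1.
  by move=> e; rewrite size_cat size_takel ?e /= ?size_drop ?e; lia.
have nW u q : size u = size s -> (W u)`_q = if (q < i)%N then u`_q else
    if q == i then mu (tprod [tuple u`_(i + l) | l < k]) else u`_(k + q.-1).
  move=> e; rewrite nth_cat size_takel ?e; last by lia.
  case: ltnP => qi; first by rewrite nth_take.
  case: eqP => [->|ne]; first by rewrite subnn.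
  have -> : (q - i = (q - i.+1).+1)%N by lia.
  by rewrite /= nth_drop; congr nth; lia.
have Tmu : (p < i)%N || (i + k <= p)%N ->
    [tuple s1`_(i + l) | l < k] = [tuple s`_(i + l) | l < k] /\
    [tuple s2`_(i + l) | l < k] = [tuple s`_(i + l) | l < k].
  move=> hp; split; apply: eq_from_tnth => l; rewrite !tnth_mktuple;
  by case: (eq (i + l)%N) => //; have := ltn_ord l; lia.
have [pi|ip] := ltnP p i.
  have [//|T1 T2] := Tmu; first by rewrite pi.
  apply: (@word_slot _ _ c p); split; rewrite ?szW //; first by lia.
    by rewrite !nW // pi.
  move=> q nq; rewrite !nW // T1 T2; case: ltnP => qi; first exact: eq.
  by case: (q =P i) => // ne; apply: eq; lia.
have [pk|kp] := ltnP p (i + k).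
  apply: (@word_slot _ _ c i); split; rewrite ?szW //; first by lia.
    rewrite !nW // ltnn eqxx -linearP; congr (mu _).
    have lk : (p - i < k)%N by lia.
    apply: (@tprod_multilinear _ _ _ (Ordinal lk)).
      by rewrite !tnth_mktuple /= subnKC.
    move=> j; rewrite -val_eqE /= => nj; rewrite !tnth_mktuple; apply: eq.
    by lia.
  move=> q nq; rewrite !nW // (negbTE nq).
  by case: ltnP => qi; apply: eq; lia.
have [|T1 T2] := Tmu; first by rewrite kp orbT.
apply: (@word_slot _ _ c (p - k).+1); split; rewrite ?szW //; first by lia.
  rewrite !nW // T1 T2.
  have -> : ((p - k).+1 < i)%N = false by lia.
  have -> : ((p - k).+1 == i) = false by lia.
  by have -> : (k + (p - k).+1.-1 = p)%N by lia.
move=> q nq; rewrite !nW // T1 T2; case: ltnP => qi; first by apply: eq; lia.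
by case: (q =P i) => // ne; apply: eq; lia.
Qed.

Lemma coder_exists : exists D, is_coder D.
Proof. by apply: tens_hlift => ds c p s s1 s2 _; exact: coder_sum_slot. Qed.

Definition coder : {linear TA A -> TA A} := projT1 (cid coder_exists).

Lemma coderP : is_coder coder.
Proof. exact: (projT2 (cid coder_exists)). Qed.

Lemma coder_unique D : is_coder D -> D =1 coder.
Proof.
move=> DE x; apply: (lspan_eq _ (hword_span x)) => _ [ds [s [hs ->]]].
by rewrite (DE _ _ hs) (coderP hs).
Qed.
End Coderivation.

(* Only mu k with k >= 1 is used; mu 0 is a dummy. The degree of mu k is taken
   with respect to the unshifted degree |a_1| + ... + |a_k|. The operators are
   indexed by k instead of 3 - 2k: since (3 - 2p) + (3 - 2q) = 6 - 2(p + q), the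
   relation indexed by n = 6 - 2N is the sum over p, q >= 1 with p + q = N, and
   there are no terms for the other values of n. *)
Record A_infinity (R : comPzRingType) (A : gradedModule R)
    (mu : forall k, {linear tpow A k -> A}) : Prop := AInfinity {
  A_infinity_degree : forall k (ds : seq int) (t : k.-tuple A),
    (0 < k)%N -> homogs ds t ->
    homog (\sum_(d <- ds) d + 2 - k%:Z) (mu k (tprod t));
  A_infinity_rel : forall (N : nat) (x : TA A),
    \sum_(1 <= p < N) coder (mu p) (coder (mu (N - p)%N) x) = 0
}.

Section BV.
Variables (R : comPzRingType) (X : gradedModule R) (mul : X -> X -> X).

Record graded_comm_algebra : Prop := GradedCommAlgebra {
  gca_linearl : forall y, linear (mul^~ y);
  gca_linearr : forall x, linear (mul x);
  gca_homog : forall i j x y, homog i x -> homog j y -> homog (i + j) (mul x y);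
  gca_assoc : associative mul;
  gca_unit : exists2 e, homog 0 e & left_id e mul /\ right_id e mul;
  gca_comm : forall i j x y, homog i x -> homog j y ->
    mul x y = ksign R (i * j) *: mul y x
}.

Definition has_degree (e : int) (D : X -> X) : Prop :=
  forall i x, homog i x -> homog (i + e) (D x).

Record comm_dga (d : {linear X -> X}) : Prop := CommDGA {
  cdga_algebra : graded_comm_algebra;
  cdga_degree : has_degree 1 d;
  cdga_square : forall x, d (d x) = 0;
  cdga_leibniz : forall i x y, homog i x ->
    d (mul x y) = mul (d x) y + ksign R i *: mul x (d y)
}.

(* Left-bracketed product; it is only applied to nonempty sequences below. *)
Definition mprod (s : seq X) : X := if s is x :: s' then foldl mul x s' else 0.

(* Moving the x_i with i in I to the front reverses the pairs p < q with q in I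
   and p not in I. *)
Definition koszul_exponent n (ds : 'I_n -> int) (I : {set 'I_n}) : int :=
  \sum_(p : 'I_n * 'I_n | [&& (p.1 < p.2)%N, p.1 \notin I & p.2 \in I])
     ds p.1 * ds p.2.

Definition operator_order (n : nat) (D : X -> X) : Prop :=
  forall (ds : 'I_n.+1 -> int) (x : 'I_n.+1 -> X),
    (forall i, homog (ds i) (x i)) ->
    \sum_(I : {set 'I_n.+1} | I != set0)
       ksign R ((n.+1 - #|I|)%:Z + koszul_exponent ds I) *:
         mprod (D (mprod [seq x i | i in I]) :: [seq x i | i in ~: I]) = 0.

(* Delta k stands for Delta_{3-2k}, k >= 1 (Delta 0 is a dummy), and Delta 1 is
   the differential; the relations are indexed as in A_infinity. *)
Record BV_infinity (Delta : nat -> {linear X -> X}) : Prop := BVInfinity {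
  BV_dga : comm_dga (Delta 1%N);
  BV_degree : forall k, (0 < k)%N -> has_degree (3 - 2 * k%:Z) (Delta k);
  BV_order : forall k, (0 < k)%N -> operator_order k (Delta k);
  BV_rel : forall (N : nat) (x : X),
    \sum_(1 <= p < N) Delta p (Delta (N - p)%N x) = 0
}.
End BV.

(* Main.v *)
Require Import Defs.
From mathcomp Require Import all_boot all_algebra.
From mathcomp Require Import fingroup perm boolp zify.

(** Only the bound on the operator-order needs an idea.  The order of an operator
    D with D 1 = 0 on a graded commutative algebra is controlled by its iterated
    graded commutators with multiplications: the alternating sum over subsets
    that defines order n is [...[[D, x_1], x_2]..., x_(n+1)] applied to 1
    ([brackets_expand], [operator_order_brackets]).  So it suffices to see that
    k + 1 such commutators kill the coderivation D of a k-ary map mu.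

    The coderivation cuts a word in all ways as w = u v z and replaces the middle
    piece v, of length k, by mu v: D w is the sum over the cuts of H u v z with
    H u v z = +- u (mu v) z.  Call an operator T local of width m if T w is
    the sum over the cuts w = u v z of H u v z, where the kernel H vanishes as
    soon as v has at least m letters and multiplication by a word y acts on
    H u v z by cutting y in two and shuffling the two pieces into u and z
    ([local_operator], [spread]).  As deconcatenation is multiplicative for the
    shuffle product ([shsum_cut]), T (x * w) is the sum, over the cuts u v z of w
    and x1 x2 x3 of x, of H at the three shuffles of u with x1, of v with x2 and
    of z with x3 ([shsum_cut3]); by the second condition on H, the terms in which
    x2 is empty add up to x * T w.  They cancel in [T, x]; in the others the
    middle piece already contains a letter of x, so [T, x] is local of width
    m - 1 ([local_bracket]).  Now D is local of width k + 1 and an operator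
    of width 0 is zero.  The Leibniz rule for the differential is the case k = 1.

    That the kernel of a commutator still has the second property amounts to
    commuting two triple shuffles ([shift3C]), which follows from associativity
    and commutativity of the shuffle product.  To prove these, sums over shuffle
    permutations are first replaced by sums that are defined by recursion on the
    first letter ([shuffle_sum_rec]); all identities between shuffles are then
    inductions on words, and every sign is a statement about parities, settled
    by going through their values ([sign_eq]). *)

Set Implicit Arguments.
Unset Strict Implicit.
Unset Printing Implicit Defensive.

Import GRing.Theory.
Local Open Scope ring_scope.

(** * Signs *)

Definition oddz (i : int) : bool := odd `|i|%N.

Lemma oddzD i j : oddz (i + j) = oddz i (+) oddz j.
Proof. rewrite /oddz; lia. Qed.

Lemma oddzM i j : oddz (i * j) = oddz i && oddz j.
Proof. by rewrite /oddz abszM oddM. Qed.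

Lemma oddzN i : oddz (- i) = oddz i.
Proof. by rewrite /oddz abszN. Qed.

Section Signs.
Variable R : comPzRingType.

Lemma ksignE i : ksign R i = (-1) ^+ oddz i.
Proof. by rewrite /ksign /oddz signr_odd. Qed.

Lemma ksignD i j : ksign R (i + j) = ksign R i * ksign R j.
Proof. by rewrite !ksignE oddzD signr_addb. Qed.

Lemma eq_ksign i j : oddz i = oddz j -> ksign R i = ksign R j.
Proof. by rewrite !ksignE => ->. Qed.
End Signs.

Ltac oddz_cases :=
  repeat (let b := fresh "b" in set b := oddz _; case: b => //=).

Ltac sign_eq := apply: eq_ksign; rewrite !(oddzD, oddzM); oddz_cases.

(** * Words of homogeneous letters *)

Section Words.
Variables (R : comPzRingType) (A : gradedModule R).

(** A letter carries a degree and the proof that its value has this degree, so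
    that every list of letters has signs and a degree, without side conditions
    on homogeneity. *)
Record letter := Letter {
  ldeg : int;
  lval : A;
  lvalP : homog ldeg lval
}.

Implicit Types (a b : letter) (s t u v w x y z : seq letter).

(** The degree in the tensor algebra: every letter is shifted by one.  Its parity
    governs the Koszul signs. *)
Definition sdeg s : int := \sum_(a <- s) (ldeg a + 1).

Lemma sdeg0 : sdeg [::] = 0. Proof. exact: big_nil. Qed.
Lemma sdeg_cons a s : sdeg (a :: s) = ldeg a + 1 + sdeg s.
Proof. exact: big_cons. Qed.
Lemma sdeg_cat s t : sdeg (s ++ t) = sdeg s + sdeg t.
Proof. exact: big_cat. Qed.

Definition lword s : TA A := word (map lval s).

Lemma homogs_letters s : homogs (map ldeg s) (map lval s).
Proof. by elim: s => //= a s; split; first exact: lvalP. Qed.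

Lemma lettersP ds (r : seq A) : homogs ds r ->
  exists s, map ldeg s = ds /\ map lval s = r.
Proof.
elim: ds r => [|d ds IH] [|r0 r] //=; first by exists [::].
by case=> h0 /IH[s [<- <-]]; exists (Letter h0 :: s).
Qed.

Lemma lword_span (X : TA A) : lspan (fun Y => exists s, Y = lword s) X.
Proof.
apply: lspan_trans (hword_span X) => _ [ds [r [hr ->]]].
by have [s [_ <-]] := lettersP hr; apply: lspan_gen; exists s.
Qed.

Lemma sdegE s : \sum_(d <- map ldeg s) d + (size (map lval s))%:Z = sdeg s.
Proof.
rewrite size_map /sdeg big_split big_map /=; congr (_ + _).
elim: s => [|a s IH]; first by rewrite big_nil.
by rewrite big_cons -IH /= -intS.
Qed.

Lemma homog_lword s : homog (sdeg s) (lword s).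
Proof.
apply: lspan_gen; exists (map ldeg s), (map lval s).
by split=> //; [exact: homogs_letters | exact: sdegE].
Qed.

Lemma homog_span e (X : TA A) :
  homog e X -> lspan (fun Y => exists2 s, sdeg s = e & Y = lword s) X.
Proof.
apply: lspan_trans => _ [ds [r [hr <- ->]]].
have [s [<- <-]] := lettersP hr; apply: lspan_gen; exists s => //.
by rewrite sdegE.
Qed.

(** * Sums over shuffles and over cuts *)

Section Sums.
Variable V : lmodType R.
Implicit Types (F : seq letter -> V) (G : seq letter -> seq letter -> V).

(** [shsum s t F] is the signed sum of F over the shuffles of s and t; the first
    letter of a shuffle comes from s, or from t at the price of jumping over all
    of s.  Taking an arbitrary F, instead of the shuffle product itself, lets
    shuffles be nested and a letter be added in front by changing F. *)
Fixpoint shsum_rec s : seq letter -> (seq letter -> V) -> V :=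
  fix sh_s t F : V :=
    match s, t with
    | [::], _ => F t
    | _, [::] => F s
    | a :: s', b :: t' =>
        shsum_rec s' t (fun w => F (a :: w)) +
        ksign R ((ldeg b + 1) * sdeg s) *: sh_s t' (fun w => F (b :: w))
    end.
(* Locked, since rewriting with laws of V would otherwise unfold the sums. *)
Definition shsum := locked shsum_rec.

(** The same device for the deconcatenation coproduct. *)
Fixpoint cutsum_rec s G : V :=
  if s is a :: s' then G [::] s + cutsum_rec s' (fun u v => G (a :: u) v)
  else G [::] [::].
Definition cutsum := locked cutsum_rec.

Lemma shsum0s t F : shsum [::] t F = F t.
Proof. by rewrite /shsum -lock; case: t. Qed.
Lemma shsums0 s F : shsum s [::] F = F s.
Proof. by rewrite /shsum -lock; case: s. Qed.
Lemma shsum_cons a s b t F : shsum (a :: s) (b :: t) F =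
  shsum s (b :: t) (fun w => F (a :: w)) +
  ksign R ((ldeg b + 1) * sdeg (a :: s)) *:
    shsum (a :: s) t (fun w => F (b :: w)).
Proof. by rewrite /shsum -lock. Qed.
Lemma cutsum0 G : cutsum [::] G = G [::] [::].
Proof. by rewrite /cutsum -lock. Qed.
Lemma cutsum_cons a s G :
  cutsum (a :: s) G = G [::] (a :: s) + cutsum s (fun u v => G (a :: u) v).
Proof. by rewrite /cutsum -lock. Qed.

(** A linear J on families commutes with both kinds of sums.  For J a second
    sum this is the interchange of summations, for J a linear map applied to a
    single vector it is linearity: one induction gives both. *)
Definition linear_functional (I : Type) (J : (I -> V) -> V) :=
  forall c K1 K2, J (fun i => c *: K1 i + K2 i) = c *: J K1 + J K2.

Lemma shsum_functional (I : Type) (J : (I -> V) -> V) s t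
    (H : I -> seq letter -> V) :
  linear_functional J ->
  J (fun i => shsum s t (H i)) = shsum s t (fun w => J (fun i => H i w)).
Proof.
move=> Jl.
have JD K1 K2 : J (fun i => K1 i + K2 i) = J K1 + J K2.
  have := Jl 1 K1 K2; rewrite scale1r => <-; congr J; apply/funext => i.
  by rewrite scale1r.
elim: s t H => [|a s IHs] t H.
  by rewrite shsum0s; congr J; apply/funext => i; rewrite shsum0s.
elim: t H => [|b t IHt] H.
  by rewrite shsums0; congr J; apply/funext => i; rewrite shsums0.
rewrite shsum_cons -IHs -IHt addrC -Jl; congr J; apply/funext => i.
by rewrite shsum_cons addrC.
Qed.

Lemma cutsum_functional (I : Type) (J : (I -> V) -> V) s
    (H : I -> seq letter -> seq letter -> V) :
  linear_functional J ->
  J (fun i => cutsum s (H i)) = cutsum s (fun u v => J (fun i => H i u v)).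
Proof.
move=> Jl.
have JD K1 K2 : J (fun i => K1 i + K2 i) = J K1 + J K2.
  have := Jl 1 K1 K2; rewrite scale1r => <-; congr J; apply/funext => i.
  by rewrite scale1r.
elim: s H => [|a s IHs] H.
  by rewrite cutsum0; congr J; apply/funext => i; rewrite cutsum0.
rewrite cutsum_cons -IHs -JD; congr J; apply/funext => i.
by rewrite cutsum_cons.
Qed.

Lemma shsum_linear s t : linear_functional (shsum s t).
Proof.
elim: s t => [|a s IHs] t; first by move=> c F F'; rewrite !shsum0s.
elim: t => [|b t IHt] c F F'; first by rewrite !shsums0.
rewrite !shsum_cons IHs IHt !scalerDr !scalerA [ksign R _ * c]mulrC.
by rewrite addrACA.
Qed.

Lemma cutsum_linear s (K1 K2 : seq letter -> seq letter -> V) c :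
  cutsum s (fun u v => c *: K1 u v + K2 u v) = c *: cutsum s K1 + cutsum s K2.
Proof.
elim: s K1 K2 => [|a s IHs] K1 K2; first by rewrite !cutsum0.
by rewrite !cutsum_cons IHs scalerDr addrACA.
Qed.

(** All that is used of a shuffle w of s and t is its size and its degree.  With
    equality as Q this lemma is extensionality, with a membership as Q it puts a
    shuffle sum in a submodule. *)
Lemma shsum_rel (Q : V -> V -> Prop) s t F F' :
  (forall c X X' Y Y', Q X X' -> Q Y Y' -> Q (c *: X + Y) (c *: X' + Y')) ->
  (forall w, size w = (size s + size t)%N -> sdeg w = sdeg s + sdeg t ->
     Q (F w) (F' w)) ->
  Q (shsum s t F) (shsum s t F').
Proof.
move=> Ql; elim: s t F F' => [|a s IHs] t F F' h.
  by rewrite !shsum0s; apply: h; rewrite ?sdeg0 ?add0r.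
elim: t F F' h => [|b t IHt] F F' h.
  by rewrite !shsums0; apply: h; rewrite ?addn0 ?sdeg0 ?addr0.
rewrite !shsum_cons addrC [X in Q _ X]addrC; apply: Ql.
  apply: IHt => w e1 e2; apply: h; first by rewrite /= e1 addnS.
  by rewrite !sdeg_cons in e2 *; lia.
apply: IHs => w e1 e2; apply: h; first by rewrite /= e1.
by rewrite !sdeg_cons in e2 *; lia.
Qed.

Lemma eq_shsum s t F F' :
  (forall w, size w = (size s + size t)%N -> sdeg w = sdeg s + sdeg t ->
     F w = F' w) -> shsum s t F = shsum s t F'.
Proof. by move=> h; apply: shsum_rel => // c X X' Y Y' -> ->. Qed.

Lemma eq_cutsum s G G' :
  (forall u v, u ++ v = s -> G u v = G' u v) -> cutsum s G = cutsum s G'.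
Proof.
elim: s G G' => [|a s IHs] G G' h; first by rewrite !cutsum0; exact: h.
rewrite !cutsum_cons h // (IHs _ (fun u v => G' (a :: u) v)) // => u v e.
by rewrite h //= e.
Qed.

Lemma shsumZ c s t F : shsum s t (fun w => c *: F w) = c *: shsum s t F.
Proof.
have := shsum_functional s t (fun _ : unit => F) (J := fun K => c *: K tt).
by move=> -> // d K1 K2; rewrite scalerDr !scalerA mulrC.
Qed.

Lemma cutsumZ c s G : cutsum s (fun u v => c *: G u v) = c *: cutsum s G.
Proof.
have := cutsum_functional s (fun _ : unit => G) (J := fun K => c *: K tt).
by move=> -> // d K1 K2; rewrite scalerDr !scalerA mulrC.
Qed.

Lemma shsumD s t F F' :
  shsum s t (fun w => F w + F' w) = shsum s t F + shsum s t F'.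
Proof.
have := shsum_linear s t 1 F F'; rewrite scale1r => <-.
by congr shsum; apply/funext=> w; rewrite scale1r.
Qed.

Lemma cutsumD s G G' :
  cutsum s (fun u v => G u v + G' u v) = cutsum s G + cutsum s G'.
Proof.
have := cutsum_linear s G G' 1; rewrite scale1r => <-.
by apply: eq_cutsum => u v _; rewrite scale1r.
Qed.

Lemma shsum_exchange s t x y (H : seq letter -> seq letter -> V) :
  shsum s t (fun w => shsum x y (H w)) =
  shsum x y (fun w' => shsum s t (fun w => H w w')).
Proof. exact: (shsum_functional x y H (@shsum_linear s t)). Qed.

Lemma shsum_cut_exchange s t x (H : seq letter -> seq letter -> seq letter -> V) :
  shsum s t (fun w => cutsum x (H w)) =
  cutsum x (fun u v => shsum s t (fun w => H w u v)).
Proof. exact: (cutsum_functional x H (@shsum_linear s t)). Qed.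

Lemma cutsum_exchange x y
    (H : seq letter -> seq letter -> seq letter -> seq letter -> V) :
  cutsum x (fun u v => cutsum y (H u v)) =
  cutsum y (fun p q => cutsum x (fun u v => H u v p q)).
Proof.
exact: (cutsum_functional (J := fun K => cutsum x (fun u v => K (u, v))) y
  (fun i => H i.1 i.2) (fun c K1 K2 => cutsum_linear x _ _ c)).
Qed.

End Sums.

Section Laws.
Variable V : lmodType R.
Implicit Types (F : seq letter -> V) (G : seq letter -> seq letter -> V).

Lemma shsumC s t F : shsum s t F = ksign R (sdeg s * sdeg t) *: shsum t s F.
Proof.
elim: s t F => [|a s IHs] t F.
  by rewrite shsum0s shsums0 sdeg0 mul0r scale1r.
elim: t F => [|b t IHt] F.
  by rewrite shsum0s shsums0 sdeg0 mulr0 scale1r.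
rewrite !shsum_cons IHs IHt addrC scalerDr !scalerA -!ksignD !sdeg_cons.
by congr (_ *: _ + _ *: _); sign_eq.
Qed.

(** Both sides sum over the shuffles of three words; they are expanded in the
    same way according to the word which provides the first letter. *)
Lemma shsumA s t r F :
  shsum s t (fun w => shsum w r F) = shsum t r (fun w => shsum s w F).
Proof.
elim: s t r F => [|a s IHs] t r F.
  by rewrite shsum0s; apply: eq_shsum => w _ _; rewrite shsum0s.
elim: t r F => [|b t IHt] r F; first by rewrite shsums0 shsum0s.
elim: r F => [|c r IHr] F.
  by rewrite shsums0; apply: eq_shsum => w _ _; rewrite shsums0.
(* The signs of the letters b and c jumping over the words on their left. *)
pose kb := ksign R ((ldeg b + 1) * sdeg (a :: s)).
pose kc := ksign R ((ldeg c + 1) * (sdeg (a :: s) + sdeg (b :: t))).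
have EL : shsum (a :: s) (b :: t) (fun w => shsum w (c :: r) F) =
    shsum s (b :: t) (fun w => shsum w (c :: r) (fun w' => F (a :: w'))) +
    kb *: shsum (a :: s) t (fun w => shsum w (c :: r) (fun w' => F (b :: w'))) +
    kc *: shsum (a :: s) (b :: t) (fun w => shsum w r (fun w' => F (c :: w'))).
  rewrite shsum_cons (shsum_cons a s b t) -/kb.
  have -> : shsum s (b :: t) (fun w => shsum (a :: w) (c :: r) F) =
      shsum s (b :: t) (fun w => shsum w (c :: r) (fun w' => F (a :: w')) +
        kc *: shsum (a :: w) r (fun w' => F (c :: w'))).
    apply: eq_shsum => w _ e; rewrite shsum_cons; congr (_ + ksign R _ *: _).
    by rewrite !sdeg_cons in e *; lia.
  have -> : shsum (a :: s) t (fun w => shsum (b :: w) (c :: r) F) =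
      shsum (a :: s) t (fun w => shsum w (c :: r) (fun w' => F (b :: w')) +
        kc *: shsum (b :: w) r (fun w' => F (c :: w'))).
    apply: eq_shsum => w _ e; rewrite shsum_cons; congr (_ + ksign R _ *: _).
    by rewrite !sdeg_cons in e *; lia.
  rewrite !shsumD !shsumZ !scalerDr !scalerA [kc * _]mulrC addrACA -!addrA.
  by congr (_ + _); rewrite addrCA.
have ER : shsum (b :: t) (c :: r) (fun w => shsum (a :: s) w F) =
    shsum (b :: t) (c :: r) (fun w => shsum s w (fun w' => F (a :: w'))) +
    kb *: shsum t (c :: r) (fun w => shsum (a :: s) w (fun w' => F (b :: w'))) +
    kc *: shsum (b :: t) r (fun w => shsum (a :: s) w (fun w' => F (c :: w'))).
  rewrite !(shsum_cons b t).
  set k := ksign R ((ldeg c + 1) * sdeg (b :: t)).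
  have -> : shsum t (c :: r) (fun w => shsum (a :: s) (b :: w) F) =
      shsum t (c :: r) (fun w => shsum s (b :: w) (fun w' => F (a :: w')) +
        kb *: shsum (a :: s) w (fun w' => F (b :: w'))).
    by apply: eq_shsum => w _ _; rewrite shsum_cons.
  pose k' := ksign R ((ldeg c + 1) * sdeg (a :: s)).
  have -> : shsum (b :: t) r (fun w => shsum (a :: s) (c :: w) F) =
      shsum (b :: t) r (fun w => shsum s (c :: w) (fun w' => F (a :: w')) +
        k' *: shsum (a :: s) w (fun w' => F (c :: w'))).
    by apply: eq_shsum => w _ _; rewrite shsum_cons.
  have -> : kc = k * k' by rewrite -ksignD -mulrDr [sdeg (b :: t) + _]addrC.
  rewrite !shsumD !shsumZ !scalerDr !scalerA addrACA -!addrA.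
  by congr (_ + _); rewrite addrCA.
by rewrite EL ER IHs IHt IHr.
Qed.

(** Left-commutativity, which moves the factors of a nested shuffle past each
    other. *)
Lemma shsumCA x y t F : shsum x t (fun w => shsum y w F) =
  ksign R (sdeg x * sdeg y) *: shsum y t (fun w => shsum x w F).
Proof. by rewrite -!shsumA shsumC; congr (ksign R _ *: _); rewrite mulrC. Qed.

(** Deconcatenation is multiplicative for the shuffle product: to cut a shuffle
    of s and t is to cut s and t and to shuffle the left and the right pieces.
    The sign comes from t1 jumping over s2. *)
Lemma shsum_cut s t G : shsum s t (fun w => cutsum w G) =
  cutsum s (fun s1 s2 => cutsum t (fun t1 t2 => ksign R (sdeg t1 * sdeg s2) *:
    shsum s1 t1 (fun u => shsum s2 t2 (G u)))).
Proof.
elim: s t G => [|a s IHs] t G.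
  rewrite shsum0s cutsum0; apply: eq_cutsum => u v _.
  by rewrite !shsum0s sdeg0 mulr0 scale1r.
elim: t G => [|b t IHt] G.
  rewrite shsums0; apply: eq_cutsum => u v _; rewrite cutsum0.
  by rewrite !shsums0 sdeg0 mul0r scale1r.
pose k := ksign R ((ldeg b + 1) * sdeg (a :: s)).
pose M G s t := cutsum s (fun s1 s2 => cutsum t (fun t1 t2 =>
  ksign R (sdeg t1 * sdeg s2) *: shsum s1 t1 (fun u => shsum s2 t2 (G u)))).
rewrite -/(M G (a :: s) (b :: t)).
have -> : shsum (a :: s) (b :: t) (fun w => cutsum w G) =
    shsum (a :: s) (b :: t) (G [::]) +
    (M (fun u v => G (a :: u) v) s (b :: t) +
     k *: M (fun u v => G (b :: u) v) (a :: s) t).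
  rewrite /M -IHs -IHt !shsum_cons -/k addrACA -scalerDr -!shsumD.
  by congr (_ + _ *: _); apply: eq_shsum => w _ _; rewrite cutsum_cons.
rewrite [RHS]/M cutsum_cons.
have -> : cutsum (b :: t) (fun t1 t2 => ksign R (sdeg t1 * sdeg (a :: s)) *:
    shsum [::] t1 (fun u => shsum (a :: s) t2 (G u))) = shsum (a :: s) (b :: t) (G [::]) +
    k *: cutsum t (fun t1 t2 => ksign R (sdeg t1 * sdeg (a :: s)) *:
      shsum (a :: s) t2 (G (b :: t1))).
  rewrite cutsum_cons shsum0s sdeg0 mul0r scale1r -cutsumZ; congr (_ + _).
  apply: eq_cutsum => u v _; rewrite shsum0s scalerA -ksignD sdeg_cons.
  by congr (_ *: _); sign_eq.
rewrite -addrA [M _ (a :: s) t]/M cutsum_cons.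
have -> : cutsum t (fun t1 t2 => ksign R (sdeg t1 * sdeg (a :: s)) *:
    shsum [::] t1 (fun u => shsum (a :: s) t2 (fun v => G (b :: u) v))) =
    cutsum t (fun t1 t2 => ksign R (sdeg t1 * sdeg (a :: s)) *:
      shsum (a :: s) t2 (G (b :: t1))).
  by apply: eq_cutsum => u v _; rewrite shsum0s.
rewrite scalerDr [M _ s _ + _]addrCA; congr (_ + (_ + _)).
rewrite /M -cutsumZ -cutsumD; apply: eq_cutsum => u v e.
rewrite !cutsum_cons !shsums0 -addrA; congr (_ + _).
rewrite -cutsumZ -cutsumD; apply: eq_cutsum => p q _.
rewrite shsum_cons scalerDr !scalerA -!ksignD /k; congr (_ + _ *: _).
by rewrite -e !(sdeg_cons, sdeg_cat); sign_eq.
Qed.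

(** A marked letter a stays in place in a shuffle of u a z with x, so it cuts x
    into the letters which come before a and those which come after. *)
Lemma shsum_mark x u a z F : shsum x (u ++ a :: z) F =
  cutsum x (fun x1 x2 => ksign R (sdeg x2 * sdeg (u ++ [:: a])) *:
    shsum x1 u (fun u' => shsum x2 z (fun z' => F (u' ++ a :: z')))).
Proof.
elim: u x F => [|b u IHu] x F.
  elim: x F => [|c x IHx] F.
    by rewrite cutsum0 !shsum0s sdeg0 mul0r scale1r.
  rewrite shsum_cons IHx cutsum_cons addrC shsum0s /=; congr (_ + _).
    by congr (_ *: _); rewrite !sdeg_cons sdeg0; sign_eq.
  by apply: eq_cutsum => p q _; rewrite !shsums0.
elim: x F => [|c x IHx] F.
  by rewrite cutsum0 !shsum0s sdeg0 mul0r scale1r.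
rewrite cat_cons shsum_cons IHx IHu !cutsum_cons scalerDr addrCA; congr (_ + _).
  by rewrite !shsum0s scalerA -ksignD !sdeg_cons; congr (_ *: _); sign_eq.
rewrite -cutsumZ -cutsumD; apply: eq_cutsum => p q e.
rewrite shsum_cons !scalerDr !scalerA -!ksignD; congr (_ + _ *: _).
by rewrite -e !(sdeg_cons, sdeg_cat); sign_eq.
Qed.

Definition cutsum3 w (H : seq letter -> seq letter -> seq letter -> V) : V :=
  cutsum w (fun u t => cutsum t (H u)).

(** The action of x1, x2, x3 on the three arguments of H by shuffling.  The sign
    is that of taking x1 x2 x3 u v z to x1 u x2 v x3 z. *)
Definition shift3 x1 x2 x3 (H : seq letter -> seq letter -> seq letter -> V) u v z :=
  ksign R (sdeg u * (sdeg x2 + sdeg x3) + sdeg v * sdeg x3) *: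
    shsum x1 u (fun u' => shsum x2 v (fun v' => shsum x3 z (H u' v'))).

Lemma shsum_cut3 x w H : shsum x w (fun w' => cutsum3 w' H) =
  cutsum3 w (fun u v z => cutsum3 x (fun x1 x2 x3 => shift3 x1 x2 x3 H u v z)).
Proof.
rewrite /cutsum3 shsum_cut cutsum_exchange; apply: eq_cutsum => u t _.
transitivity (cutsum x (fun x1 x' => cutsum x' (fun x2 x3 => cutsum t (fun v z =>
    shift3 x1 x2 x3 H u v z)))).
  apply: eq_cutsum => x1 x' _.
  under eq_shsum => u' _ _ do rewrite shsum_cut.
  rewrite shsum_cut_exchange -cutsumZ; apply: eq_cutsum => x2 x3 e.
  rewrite shsum_cut_exchange -cutsumZ; apply: eq_cutsum => v z _.
  rewrite /shift3 shsumZ scalerA -ksignD; congr (ksign R _ *: _).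
  by rewrite -e sdeg_cat.
by rewrite [RHS]cutsum_exchange; apply: eq_cutsum => x1 x' _; rewrite cutsum_exchange.
Qed.

(** Both composites equal three nested pairs of shuffles up to sign (E below),
    and left-commutativity exchanges each pair. *)
Lemma shift3C x1 x2 x3 y1 y2 y3 H u v z :
  shift3 x1 x2 x3 (shift3 y1 y2 y3 H) u v z =
  ksign R ((sdeg x1 + sdeg x2 + sdeg x3) * (sdeg y1 + sdeg y2 + sdeg y3)) *:
  shift3 y1 y2 y3 (shift3 x1 x2 x3 H) u v z.
Proof.
have E p1 p2 p3 q1 q2 q3 : shift3 p1 p2 p3 (shift3 q1 q2 q3 H) u v z =
    ksign R (sdeg u * (sdeg p2 + sdeg p3) + sdeg v * sdeg p3 +
      ((sdeg p1 + sdeg u) * (sdeg q2 + sdeg q3) + (sdeg p2 + sdeg v) * sdeg q3)) *: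
    shsum p1 u (fun u' => shsum q1 u' (fun u'' => shsum p2 v (fun v' => shsum q2 v' (fun v'' =>
      shsum p3 z (fun z' => shsum q3 z' (H u'' v'')))))).
  rewrite {1}/shift3 [in RHS]ksignD -[in RHS]scalerA; congr (_ *: _).
  rewrite -[RHS]shsumZ.  apply: eq_shsum => u' _ eu.
  rewrite [shsum q1 _ _]shsum_exchange -shsumZ; apply: eq_shsum => v' _ ev.
  under [X in _ = _ *: X]eq_shsum => u'' _ _ do rewrite shsum_exchange.
  rewrite [shsum q1 _ _]shsum_exchange -shsumZ; apply: eq_shsum => z' _ _.
  by rewrite /shift3 eu ev.
rewrite !E.
under [X in _ *: X = _]eq_shsum => u' _ _.
  under eq_shsum => u'' _ _.
    under eq_shsum => v' _ _.
      under eq_shsum => v'' _ _ do rewrite shsumCA.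
      rewrite shsumZ; over.
    rewrite shsumZ shsumCA scalerA; over.
  rewrite shsumZ; over.
rewrite shsumZ shsumCA !scalerA -!ksignD; congr (_ *: _).
sign_eq.
Qed.

End Laws.
End Words.

(** * Shuffle permutations *)

(** Permutations of N + 1 points are built from those of N points by fixing an
    image, which allows induction on N. *)
Lemma lift_perm_surj N (sigma : 'S_N.+1) i :
  exists s : 'S_N, sigma = lift_perm i (sigma i) s.
Proof.
pose f k := odflt k (unlift (sigma i) (sigma (lift i k))).
have fK k : lift (sigma i) (f k) = sigma (lift i k).
  rewrite /f; have := neq_lift i k; rewrite -(can_eq (permK sigma)).
  by case/unlift_some => ? ? ->.
have fI : injective f.
  move=> k l /(congr1 (lift (sigma i))); rewrite !fK => /perm_inj.
  exact: lift_inj.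
exists (perm fI); apply/permP => k; case: (unliftP i k) => [l|] ->.
  by rewrite lift_perm_lift permE fK.
by rewrite lift_perm_id.
Qed.

Lemma lift_perm_inj N (i j : 'I_N.+1) : injective (lift_perm i j).
Proof.
move=> s t e; apply/permP => k; apply: (@lift_inj _ j).
by rewrite -!(lift_perm_lift i) e.
Qed.

(** Grouping by the preimage of 0, that is, for a shuffle, by the letter which
    comes first in the shuffled word. *)
Lemma sum_perm_lift (V : nmodType) N (P : pred 'S_N.+1) (E : 'S_N.+1 -> V) :
  \sum_(sigma | P sigma) E sigma =
  \sum_(i < N.+1) \sum_(s | P (lift_perm i ord0 s)) E (lift_perm i ord0 s).
Proof.
rewrite (partition_big (fun sigma : 'S_N.+1 => (sigma^-1)%g ord0) xpredT) //=.
apply: eq_bigr => i _.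
pose g (sigma : 'S_N.+1) := odflt 1%g [pick s | lift_perm i ord0 s == sigma].
rewrite (reindex (lift_perm i ord0)) /=.
  apply: eq_bigl => s; have -> : ((lift_perm i ord0 s)^-1)%g ord0 = i.
    by apply: (@perm_inj _ (lift_perm i ord0 s)); rewrite permKV lift_perm_id.
  by rewrite eqxx andbT.
exists g => [s _|sigma].
  rewrite /g; case: pickP => [t /eqP /lift_perm_inj //|/(_ s)].
  by rewrite eqxx.
rewrite inE => /andP[_ /eqP e].
have e0 : sigma i = ord0 by rewrite -e permKV.
rewrite /g; case: pickP => [t /eqP //|].
by have [s e'] := lift_perm_surj sigma i; move=> /(_ s); rewrite -e0 -e' eqxx.
Qed.

(** With a single size N, independent of n, so that the induction can remove a
    point from either block. *)
Definition shuffles N n (sigma : 'S_N) : bool :=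
  [forall i : 'I_N, forall j : 'I_N,
     (i < j)%N && ((j < n)%N || (n <= i)%N) ==> (sigma i < sigma j)%N].

Lemma shufflesP N n (sigma : 'S_N) :
  reflect (forall i j : 'I_N, (i < j)%N -> (j < n)%N || (n <= i)%N ->
     (sigma i < sigma j)%N) (shuffles n sigma).
Proof.
apply: (iffP forallP) => [h i j ij b|h i].
  by move/forallP: (h i) => /(_ j) /implyP; apply; rewrite ij.
by apply/forallP => j; apply/implyP => /andP[]; exact: h.
Qed.

(** The first letter of a shuffle is the first letter of one of the two blocks:
    index n for the second block, and index 0 for the first one.  When n = 0 the
    two coincide and the first block is empty, hence the order of the tests. *)
Lemma shuffles_lift N n (i : 'I_N.+1) (s : 'S_N) : (n <= N.+1)%N ->
  shuffles n (lift_perm i ord0 s) =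
  if (n == i :> nat) then shuffles n s
  else (i == ord0) && shuffles n.-1 s.
Proof.
move=> nN.
have L0 k : (0 < lift_perm i ord0 s (lift i k))%N by rewrite lift_perm_lift.
have LL k l : (lift_perm i ord0 s (lift i k) < lift_perm i ord0 s (lift i l))%N
   = (s k < s l)%N.
  by rewrite !lift_perm_lift /= !/bump !leq0n ltn_add2l.
have [en|ne] := eqVneq n i.
  apply/shufflesP/shufflesP => h k l kl b.
    by rewrite -LL; apply: h; rewrite /= /bump; lia.
  case: (unliftP i k) kl b => [k'|] ->; case: (unliftP i l) => [l'|] -> kl b.
  - by rewrite LL; move: kl b; rewrite /= /bump => kl b; apply: h; lia.
  - by lia.
  - by rewrite lift_perm_id.
  - by lia.
have [i0|i0] /= := eqVneq i ord0; last first.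
  have ipos : (0 < i)%N by rewrite lt0n; move: i0; rewrite -val_eqE.
  apply/negbTE/shufflesP => h.
  have [lt|ge] := ltnP i n.
    by have := h ord0 i ipos; rewrite lt => /(_ isT); rewrite lift_perm_id.
  have ni : (n < i)%N by lia.
  have nN' : (n < N.+1)%N by exact: ltn_trans ni (ltn_ord i).
  have := h (Ordinal nN') i ni; rewrite leqnn orbT => /(_ isT).
  by rewrite lift_perm_id.
have n0 : (0 < n)%N by rewrite i0 /= in ne; lia.
rewrite {}i0 in L0 LL ne *.
apply/shufflesP/shufflesP => h k l kl b.
  by rewrite -LL; apply: h; rewrite /= /bump; lia.
case: (unliftP ord0 k) kl b => [k'|] ->; case: (unliftP ord0 l) => [l'|] -> kl b.
- by rewrite LL; move: kl b; rewrite /= /bump => kl b; apply: h; lia.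
- by [].
- by rewrite lift_perm_id.
- by [].
Qed.

(** The letter i, sent to the front, is exchanged with all the letters before it;
    the remaining inversions are those of s. *)
Lemma shuffle_exponent_lift N (ds : seq int) (i : 'I_N.+1) (s : 'S_N) :
  size ds = N.+1 ->
  shuffle_exponent ds (lift_perm i ord0 s) =
  (ds`_i + 1) * (\sum_(d <- take i ds) (d + 1)) +
  shuffle_exponent (take i ds ++ drop i.+1 ds) s.
Proof.
move=> eds; rewrite /shuffle_exponent.
pose D (p : nat) := ds`_p + 1.
have E M (P : 'I_M -> 'I_M -> bool) (f : 'I_M -> 'I_M -> int) :
    \sum_(p : 'I_M * 'I_M | P p.1 p.2) f p.1 p.2 =
    \sum_(p < M) \sum_(q < M | P p q) f p q by rewrite pair_big_dep.
rewrite (E _ (fun p q => (p < q)%N && (lift_perm i ord0 s q < lift_perm i ord0 s p)%N)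
  (fun p q => D p * D q)).
rewrite (E _ (fun p q => (p < q)%N && (s q < s p)%N)
  (fun p q => ((take i ds ++ drop i.+1 ds)`_p + 1) *
    ((take i ds ++ drop i.+1 ds)`_q + 1))).
have iN := ltn_ord i.
have sz : size (take i ds) = i by rewrite size_takel // eds ltnW.
have nthE (k : 'I_N) : (take i ds ++ drop i.+1 ds)`_k = ds`_(lift i k).
  rewrite nth_cat sz -[nat_of_ord (lift i k)]/(bump i k) /bump.
  case: ltnP => ki; first by rewrite nth_take.
  by rewrite nth_drop; congr nth; lia.
have -> : \sum_(d <- take i ds) (d + 1) = \sum_(k < N | (k < i)%N) D k.
  rewrite (big_nth 0) sz big_mkord.
  rewrite (big_ord_widen N (fun k => (take i ds)`_k + 1)) //.
  by apply: eq_bigr => k ki; rewrite nth_take.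
rewrite (bigD1_ord i) //= big1 ?add0r; last first.
  by move=> q; rewrite lift_perm_id ltn0 andbF.
rewrite big_distrr /= [in RHS]big_mkcond -big_split; apply: eq_bigr => k _ /=.
rewrite big_mkcond (bigD1_ord i) //= lift_perm_id lift_perm_lift /= andbT.
congr (_ + _).
  rewrite /D mulrC /bump; have [le|lt] := leqP i k; first by rewrite ifN //; lia.
  by rewrite lt.
rewrite [RHS]big_mkcond; apply: eq_bigr => l _.
rewrite !nthE lift_perm_lift /= /bump !leq0n ltn_add2l -/(D _).
by congr (if _ && _ then _ else _); lia.
Qed.

Section ShuffleSum.
Variables (R : comPzRingType) (A : gradedModule R) (V : lmodType R).
Implicit Types (c : seq (letter A)) (F : seq (letter A) -> V).

(** A default value for [nth]. *)
Definition letter0 : letter A := Letter (homog0 A 0).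

(** The shuffles whose first letter is the head of the first or of the second
    block give the two terms of the recursion of [shsum]. *)
Lemma shuffle_sum_rec N n c F : size c = N -> (n <= N)%N ->
  \sum_(sigma : 'S_N | shuffles n sigma)
     ksign R (shuffle_exponent (map (@ldeg R A) c) sigma) *:
       F [seq nth letter0 c ((sigma^-1)%g i) | i : 'I_N] =
  shsum (take n c) (drop n c) F.
Proof.
elim: N n c F => [|N IH] n c F ec nN.
  have -> : n = 0 by lia.
  have -> : c = [::] by case: c ec.
  rewrite (big_pred1 1%g) => [|sigma].
    rewrite shsum0s /shuffle_exponent big1 ?scale1r; last by case=> [[]].
    by congr F; apply/size0nil; rewrite size_map size_enum_ord.
  have -> : sigma = 1%g by apply/permP => [[]].
  by rewrite /= eqxx; apply/shufflesP => [[]].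
rewrite sum_perm_lift.
pose rm (i : nat) := take i c ++ drop i.+1 c.
have term (i : 'I_N.+1) (s : 'S_N) :
    ksign R (shuffle_exponent (map (@ldeg R A) c) (lift_perm i ord0 s)) *:
       F [seq nth letter0 c (((lift_perm i ord0 s)^-1)%g j) | j : 'I_N.+1] =
    ksign R ((ldeg (nth letter0 c i) + 1) * sdeg (take i c)) *:
    (ksign R (shuffle_exponent (map (@ldeg R A) (rm i)) s) *:
       F (nth letter0 c i :: [seq nth letter0 (rm i) ((s^-1)%g j) | j : 'I_N])).
  rewrite scalerA -ksignD shuffle_exponent_lift ?size_map //.
  rewrite -!map_take -!map_drop -map_cat (nth_map letter0) ?ec // /sdeg big_map.
  congr (_ *: F _); rewrite /image_mem enum_ordSl map_cons lift_permV.
  rewrite lift_perm_id -map_comp.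
  congr (_ :: _); apply: eq_map => k /=; rewrite lift_perm_lift /rm.
  have iN := ltn_ord i.
  rewrite nth_cat size_takel ?ec; last exact: ltnW.
  rewrite -[nat_of_ord (lift i _)]/(bump i _) /bump.
  case: ltnP => ki; first by rewrite nth_take //.
  by rewrite nth_drop addSn subnKC.
pose T i := \sum_(s | shuffles n (lift_perm i ord0 s))
  ksign R (shuffle_exponent (map (@ldeg R A) (rm i)) s) *:
    F (nth letter0 c i :: [seq nth letter0 (rm i) ((s^-1)%g j) | j : 'I_N]).
transitivity (\sum_(i < N.+1)
    ksign R ((ldeg (nth letter0 c i) + 1) * sdeg (take i c)) *: T i).
  by apply: eq_bigr => i _; rewrite scaler_sumr; apply: eq_bigr => s _.
have szrm (i : 'I_N.+1) : size (rm i) = N.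
  have iN := ltn_ord i.
  by rewrite size_cat size_drop size_takel ec; lia.
have T0 : n != 0 -> T ord0 = shsum (take n.-1 (behead c)) (drop n.-1 (behead c))
    (fun w => F (nth letter0 c 0 :: w)).
  move=> n0; have rm0 : rm (@ord0 N) = behead c.
    by change (take 0 c ++ drop 1 c = behead c); rewrite take0 drop1.
  rewrite -rm0 -(IH _ _ _ (szrm ord0)); last by lia.
  by apply: eq_bigl => s; rewrite shuffles_lift // (negbTE n0) eqxx.
have Tn (i : 'I_N.+1) : n = i -> T i = shsum (take n c) (drop n.+1 c)
    (fun w => F (nth letter0 c i :: w)).
  move=> ni; have iN := ltn_ord i.
  have szn : size (take n c) = n by rewrite size_takel ?ec.
  have rmn : rm i = take n c ++ drop n.+1 c by rewrite ni.
  have e1 : take n (rm i) = take n c by rewrite rmn take_size_cat.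
  have e2 : drop n (rm i) = drop n.+1 c by rewrite rmn drop_size_cat.
  rewrite -e1 -e2 -(IH _ _ _ (szrm i)); last by lia.
  by apply: eq_bigl => s; rewrite shuffles_lift // ni eqxx.
have TN (i : 'I_N.+1) : n != i -> i != ord0 -> T i = 0.
  move=> ni i0; rewrite /T big_pred0 // => s.
  by rewrite shuffles_lift // (negbTE ni) (negbTE i0).
rewrite big_ord_recl take0 sdeg0 mulr0 scale1r.
clear term szrm; clearbody T; clear rm.
case: c ec T0 Tn => [//|c0 c] [ec] T0 Tn.
have lift0 (i : 'I_N) : lift ord0 i = i.+1 :> nat by [].
case: n nN T0 Tn TN => [|m] nN T0 Tn TN.
  rewrite (Tn ord0) //= ?take0 ?drop0 !shsum0s big1 ?addr0 // => i _.
  by rewrite TN ?scaler0.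
rewrite T0 //=; have [Nm|mN] := leqP N m.
  rewrite take_oversize ?drop_oversize ?ec // !shsums0 big1 ?addr0 // => i _.
  by rewrite TN ?scaler0 //; have := ltn_ord i; rewrite lift0; lia.
have -> : drop m c = nth letter0 c m :: drop m.+1 c.
  by rewrite -drop_nth ?ec.
rewrite shsum_cons (bigD1 (Ordinal mN)) //= (Tn (lift ord0 (Ordinal mN))) //=.
rewrite big1 ?addr0 // => i; rewrite -val_eqE /= => im.
by rewrite TN ?scaler0 // lift0 eqSS eq_sym.
Qed.

End ShuffleSum.

(** * The shuffle algebra *)

Section LinearFunctions.
Variables (R : pzRingType) (U V : lmodType R).

Lemma linear_fun0 (f : U -> V) : linear f -> f 0 = 0.
Proof. by move=> fl; have := fl (-1) 0 0; rewrite scaler0 addr0 scaleN1r addNr. Qed.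

(** The properties of the shuffle product and of coderivations are checked on
    words and extended by linearity with these two lemmas. *)
Lemma linear_lspan (G : U -> Prop) (Q : V -> Prop) (f : U -> V) x : linear f ->
  Q 0 -> (forall c y z, Q y -> Q z -> Q (c *: y + z)) ->
  (forall y, G y -> Q (f y)) -> lspan G x -> Q (f x).
Proof.
move=> fl Q0 QD QG; elim=> [|c y z Gy _ IH]; first by rewrite linear_fun0.
by rewrite fl; apply: QD => //; exact: QG.
Qed.

Lemma linear_eq_lspan (G : U -> Prop) (f g : U -> V) x : linear f -> linear g ->
  (forall y, G y -> f y = g y) -> lspan G x -> f x = g x.
Proof.
move=> fl gl e; elim=> [|c y z Gy _ IH]; first by rewrite !linear_fun0.
by rewrite fl gl IH e.
Qed.
End LinearFunctions.

Section ShuffleAlgebra.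
Variables (R : comPzRingType) (A : gradedModule R).
Local Notation mul := (@shuffle R A).
Local Notation lword := (@lword R A).
Implicit Types s t : seq (letter A).

Lemma shuffle_linearl y : linear (mul^~ y).
Proof. by have [h _ _] := shuffleP A; exact: h. Qed.

Lemma shuffle_linearr x : linear (mul x).
Proof. by have [_ h _] := shuffleP A; exact: h. Qed.

Lemma shuffle_lword s t : mul (lword s) (lword t) = shsum s t lword.
Proof.
have [_ _ e] := shuffleP A.
rewrite (e _ _ _ _ (homogs_letters s) (homogs_letters t)) {e}.
rewrite /shuffle_sum !size_map -!map_cat.
have ec : size (s ++ t) = (size s + size t)%N by rewrite size_cat.
have := shuffle_sum_rec lword ec (leq_addr _ _).
rewrite take_size_cat // drop_size_cat // => <-.
apply: eq_bigr => sigma _; congr (_ *: _).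
rewrite /lword -map_comp; congr word; apply: eq_map => i /=.
by rewrite (nth_map (letter0 A)) // ec.
Qed.

Lemma linear_shsum (T : TA A -> TA A) s t F : linear T ->
  T (shsum s t F) = shsum s t (fun w => T (F w)).
Proof.
move=> Tl; apply: (shsum_functional s t (fun _ : unit => F) (J := fun K => T (K tt))).
by move=> c K1 K2; exact: Tl.
Qed.

Lemma linear_cutsum (T : TA A -> TA A) s G : linear T ->
  T (cutsum s G) = cutsum s (fun u v => T (G u v)).
Proof.
move=> Tl; apply: (cutsum_functional s (fun _ : unit => G) (J := fun K => T (K tt))).
by move=> c K1 K2; exact: Tl.
Qed.

Lemma shuffle_homog i j x y :
  homog i x -> homog j y -> homog (i + j) (mul x y).
Proof.
have h0 k : homog k (0 : TA A) by exact: homog0.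
have hL k c a b : homog k a -> homog k b -> homog k (c *: a + b :> TA A).
  exact: homogL.
move=> /homog_span hx /homog_span hy.
apply: (linear_lspan (shuffle_linearl y) (h0 _) (@hL _) _ hx) => _ [s <- ->].
apply: (linear_lspan (shuffle_linearr (lword s)) (h0 _) (@hL _) _ hy) => _ [t <- ->].
rewrite shuffle_lword.
apply: (shsum_rel (Q := fun Y _ => homog _ Y) (F' := lword)) => [c X _ Y _|w _ <-].
  exact: homogL.
exact: homog_lword.
Qed.

Lemma shuffle_comm i j x y : homog i x -> homog j y ->
  mul x y = ksign R (i * j) *: mul y x.
Proof.
have lZ c (f : TA A -> TA A) : linear f -> linear (fun y => c *: f y).
  by move=> fl d u v; rewrite fl scalerDr !scalerA mulrC.
move=> /homog_span hx /homog_span hy.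
apply: (linear_eq_lspan (f := mul^~ y) (g := fun x => _ *: mul y x)) hx.
- exact: shuffle_linearl.
- exact/lZ/shuffle_linearr.
move=> _ [s <- ->]; apply: (linear_eq_lspan (g := fun y => _ *: mul y _)) hy.
- exact: shuffle_linearr.
- exact/(lZ _ (mul^~ (lword s)))/shuffle_linearl.
by move=> _ [t <- ->]; rewrite !shuffle_lword shsumC.
Qed.

Lemma linear_comp (f g : TA A -> TA A) : linear f -> linear g ->
  linear (fun x => f (g x)).
Proof. by move=> fl gl c u v; rewrite gl fl. Qed.

Lemma shuffle_assoc : associative mul.
Proof.
move=> x y z; have [ll lr] := (shuffle_linearl, shuffle_linearr).
apply: (linear_eq_lspan (f := fun x => mul x _) (g := fun x => mul (mul x y) z)
  _ _ _ (lword_span x)) => [||_ [s ->]].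
- exact: ll.
- exact: (linear_comp (ll z) (ll y)).
apply: (linear_eq_lspan (f := fun y => mul (lword s) (mul y z))
  (g := fun y => mul (mul _ y) z) _ _ _ (lword_span y)) => [||_ [t ->]].
- exact: (linear_comp (lr _) (ll z)).
- exact: (linear_comp (ll z) (lr _)).
apply: (linear_eq_lspan (f := fun z => mul (lword s) (mul _ z)) _ _ _ (lword_span z)).
- exact: (linear_comp (lr _) (lr _)).
- exact: lr.
move=> _ [r ->]; rewrite !shuffle_lword (linear_shsum _ _ _ (lr _)).
rewrite (linear_shsum _ _ _ (ll _)).
under eq_shsum do rewrite shuffle_lword; under [RHS]eq_shsum do rewrite shuffle_lword.
by rewrite shsumA.
Qed.

Lemma shuffle1l : left_id (lword [::]) mul.
Proof.
have idl : linear (@id (TA A)) by move=> c u v.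
move=> x; apply: (linear_eq_lspan (shuffle_linearr (lword [::])) idl _ (lword_span x)).
by move=> _ [s ->]; rewrite shuffle_lword shsum0s.
Qed.

Lemma shuffle1r : right_id (lword [::]) mul.
Proof.
have idl : linear (@id (TA A)) by move=> c u v.
move=> x; apply: (linear_eq_lspan (shuffle_linearl (lword [::])) idl _ (lword_span x)).
by move=> _ [s ->]; rewrite shuffle_lword shsums0.
Qed.

Lemma homog_unit : homog 0 (lword [::]).
Proof. by rewrite -(sdeg0 A); exact: homog_lword. Qed.

Lemma shuffle_algebra : graded_comm_algebra mul.
Proof.
split.
- exact: shuffle_linearl.
- exact: shuffle_linearr.
- exact: shuffle_homog.
- exact: shuffle_assoc.
- exists (lword [::]); first exact: homog_unit.
  by split; [exact: shuffle1l | exact: shuffle1r].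
- exact: shuffle_comm.
Qed.
End ShuffleAlgebra.

(** * Kernels on cut words *)

Section CutSums.
Variables (R : comPzRingType) (A : gradedModule R) (V : lmodType R).
Implicit Types (s t u v w x y z : seq (letter A)).
Implicit Types (G : seq (letter A) -> seq (letter A) -> V).

Lemma cutsum_big s G :
  cutsum s G = \sum_(0 <= i < (size s).+1) G (take i s) (drop i s).
Proof.
elim: s G => [|a s IHs] G; first by rewrite cutsum0 big_nat1.
by rewrite cutsum_cons IHs [RHS]big_nat_recl.
Qed.

Lemma cutsum_head s G :
  (forall u v, u ++ v = s -> (0 < size u)%N -> G u v = 0) -> cutsum s G = G [::] s.
Proof.
move=> h; rewrite cutsum_big big_nat_recl // take0 drop0 big_nat big1 ?addr0 //.
move=> i /= hi; apply: h; first exact: cat_take_drop.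
by rewrite size_takel; lia.
Qed.

Lemma cutsum_size k s G :
  cutsum s (fun u v => if size u == k then G u v else 0) =
  if (k <= size s)%N then G (take k s) (drop k s) else 0.
Proof.
rewrite cutsum_big; case: leqP => ks.
  rewrite (bigD1_seq k) ?mem_index_iota ?iota_uniq //= size_takel // eqxx.
  rewrite big_nat_cond big1 ?addr0 // => i /andP[/andP[_ ile] ik].
  by rewrite size_takel ?(negbTE ik) // -ltnS.
rewrite big_nat big1 // => i /= ile; rewrite size_takel // ifN //; lia.
Qed.

Lemma cutsum_const0 s : cutsum s (fun _ _ => 0 : V) = 0.
Proof. by rewrite cutsum_big big1. Qed.

Lemma shsum_const0 s t : shsum s t (fun _ => 0 : V) = 0.
Proof.
rewrite -[RHS](scale0r (shsum s t (fun _ => 0 : V))) -shsumZ.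
by apply: eq_shsum => w _ _; rewrite scaler0.
Qed.

Lemma cutsum_closed (Q : V -> Prop) s G :
  (forall X Y, Q X -> Q Y -> Q (X + Y)) ->
  (forall u v, u ++ v = s -> Q (G u v)) -> Q (cutsum s G).
Proof.
move=> QD; elim: s G => [|a s IHs] G h; first by rewrite cutsum0; exact: h.
rewrite cutsum_cons; apply: QD; first exact: h.
by apply: IHs => u v e; apply: h; rewrite /= e.
Qed.
End CutSums.

Section Kernels.
Variables (R : comPzRingType) (A : gradedModule R).
Local Notation lword := (@lword R A).
Implicit Types (s t u v w x y z : seq (letter A)).
Implicit Types (H K : seq (letter A) -> seq (letter A) -> seq (letter A) -> TA A).

Lemma shift3_linear x1 x2 x3 c H K u v z :
  shift3 x1 x2 x3 (fun u v z => c *: H u v z + K u v z) u v z =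
  c *: shift3 x1 x2 x3 H u v z + shift3 x1 x2 x3 K u v z.
Proof.
rewrite /shift3 scalerA [c * _]mulrC -scalerA -scalerDr -shsum_linear; congr (_ *: _).
apply: eq_shsum => u' _ _; rewrite -shsum_linear; apply: eq_shsum => v' _ _.
exact: shsum_linear.
Qed.

Lemma shift3_const0 x1 x2 x3 u v z :
  shift3 x1 x2 x3 (fun _ _ _ => 0 : TA A) u v z = 0.
Proof.
rewrite /shift3; under eq_shsum => u' _ _.
  under eq_shsum do rewrite shsum_const0.
  rewrite shsum_const0; over.
by rewrite shsum_const0 scaler0.
Qed.

Lemma shift3_shuffle y x1 x2 x3 H u v z :
  shuffle (lword y) (shift3 x1 x2 x3 H u v z) =
  shift3 x1 x2 x3 (fun u v z => shuffle (lword y) (H u v z)) u v z.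
Proof.
have lr := shuffle_linearr (lword y).
rewrite /shift3 -[X in shuffle _ X]addr0 lr linear_fun0 // addr0; congr (_ *: _).
rewrite (linear_shsum _ _ _ lr); apply: eq_shsum => u' _ _.
rewrite (linear_shsum _ _ _ lr); apply: eq_shsum => v' _ _.
by rewrite (linear_shsum _ _ _ lr).
Qed.

Lemma shift3_cutsum y x1 x2 x3 (G : seq (letter A) -> seq (letter A) -> _) u v z :
  shift3 x1 x2 x3 (fun u v z => cutsum y (fun p q => G p q u v z)) u v z =
  cutsum y (fun p q => shift3 x1 x2 x3 (G p q) u v z) :> TA A.
Proof.
rewrite /shift3 cutsumZ -shsum_cut_exchange; congr (_ *: _); apply: eq_shsum => u' _ _.
rewrite -shsum_cut_exchange; apply: eq_shsum => v' _ _.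
by rewrite -shsum_cut_exchange.
Qed.

(** Multiplying the value H u v z by y spreads y over u and z and leaves v alone,
    up to the sign of moving y past an object of degree g.  For the kernel of a
    coderivation v has become a single letter, which nothing can be shuffled
    into. *)
Definition spread g H := forall y u v z, shuffle (lword y) (H u v z) =
  ksign R (g * sdeg y) *: cutsum y (fun y1 y2 => shift3 y1 [::] y2 H u v z).

Lemma spreadD g c H K : spread g H -> spread g K ->
  spread g (fun u v z => c *: H u v z + K u v z).
Proof.
move=> hH hK y u v z; rewrite (shuffle_linearr (lword y)) hH hK.
rewrite scalerA [c * _]mulrC -scalerA -scalerDr -cutsum_linear; congr (_ *: _).
by apply: eq_cutsum => y1 y2 _; rewrite shift3_linear.
Qed.

Lemma spread_cutsum g x (G : seq (letter A) -> seq (letter A) -> _) :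
  (forall p q, p ++ q = x -> spread g (G p q)) ->
  spread g (fun u v z => cutsum x (fun p q => G p q u v z)).
Proof.
move=> h y u v z; rewrite (linear_cutsum _ _ (shuffle_linearr (lword y))).
under [in RHS]eq_cutsum do rewrite shift3_cutsum.
rewrite cutsum_exchange -cutsumZ; apply: eq_cutsum => p q e; exact: h.
Qed.

(** Multiplication by y is applied under the sums of [shift3]; then y, cut in two,
    has to be moved past x1 x2 x3. *)
Lemma spread_shift3 g x1 x2 x3 H : spread g H ->
  spread (g + (sdeg x1 + sdeg x2 + sdeg x3)) (shift3 x1 x2 x3 H).
Proof.
move=> h y u v z; rewrite shift3_shuffle.
transitivity (shift3 x1 x2 x3 (fun u v z => ksign R (g * sdeg y) *:
    cutsum y (fun y1 y2 => shift3 y1 [::] y2 H u v z) + 0) u v z).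
  by congr shift3; do 3!apply/funext => ?; rewrite addr0.
rewrite (shift3_linear _ _ _ _ _ (fun _ _ _ => 0)) shift3_const0 addr0 shift3_cutsum.
rewrite -!cutsumZ; apply: eq_cutsum => y1 y2 e.
rewrite shift3C sdeg0 scalerA -ksignD -e sdeg_cat; congr (_ *: _).
sign_eq.
Qed.
End Kernels.

Section Coderivation.
Variables (R : comPzRingType) (A : gradedModule R).
Variables (k : nat) (mu : {linear tpow A k -> A}).
Hypothesis mu_degree : forall (ds : seq int) (t : k.-tuple A),
  homogs ds t -> homog (\sum_(d <- ds) d + 2 - k%:Z) (mu (tprod t)).
Local Notation lword := (@lword R A).
Implicit Types (s t u v w x y z : seq (letter A)).

(** Zero on words of the wrong length, so as to be homogeneous of the expected
    degree for every v. *)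
Definition mu_val v : A :=
  if size v == k then mu (tprod [tuple (map (@lval R A) v)`_l | l < k]) else 0.

Lemma mu_valP v : homog (\sum_(d <- map (@ldeg R A) v) d + 2 - k%:Z) (mu_val v).
Proof.
rewrite /mu_val; case: eqP => [e|_]; last exact: homog0.
apply: mu_degree; set t := mktuple _.
suff -> : t = map (@lval R A) v :> seq A by exact: homogs_letters.
apply: (@eq_from_nth _ 0) => [|i]; rewrite size_tuple ?size_map // => ik.
by rewrite -[i]/(nat_of_ord (Ordinal ik)) -tnth_nth tnth_mktuple.
Qed.

Definition mu_letter v : letter A := Letter (mu_valP v).

Lemma sdeg_letters v : sdeg v = \sum_(d <- map (@ldeg R A) v) d + (size v)%:Z.
Proof. by rewrite -sdegE size_map. Qed.

Definition mu_sign v : int :=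
  \sum_(0 <= l < k) (k - l.+1)%:Z * (map (@ldeg R A) v)`_l.

Definition coder_kernel u v z : TA A :=
  if size v == k then
    ksign R (sdeg u + mu_sign v) *: lword (u ++ mu_letter v :: z)
  else 0.

Lemma coder_lword s : coder mu (lword s) = cutsum3 s coder_kernel.
Proof.
rewrite /lword (coderP mu (homogs_letters s)) /coder_sum size_map.
rewrite /cutsum3 cutsum_big (big_nat_widen 0 _ (size s).+1) ?leq_subr // big_mkcond.
apply: eq_big_nat => i /= /[1!ltnS] ile.
rewrite /coder_kernel cutsum_size size_drop.
have -> : (i < (size s).+1 - k)%N = (k <= size s - i)%N by lia.
case: ifP => // ik; rewrite drop_drop [(k + i)%N]addnC.
congr (ksign R _ *: _).
  rewrite /coder_exponent /sdeg (big_nth (letter0 A)) size_takel //.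
  congr (_ + _); apply: eq_big_nat => l /= lk.
    rewrite nth_take; last by [].
    by rewrite (nth_map (letter0 A)) //; lia.
  by rewrite map_take nth_take // map_drop nth_drop.
rewrite /lword map_cat /= map_take map_drop; congr (word (_ ++ _ :: _)).
have sz : size (take k (drop i s)) = k by rewrite size_takel // size_drop.
rewrite /mu_val sz eqxx; congr (mu (tprod _)).
apply: eq_from_tnth => l; rewrite !tnth_mktuple.
by rewrite map_take nth_take // map_drop nth_drop.
Qed.

Lemma sdeg_mu_letter v : size v = k ->
  ldeg (mu_letter v) + 1 = sdeg v + 3 - 2 * k%:Z.
Proof. by move=> e; rewrite sdeg_letters e /=; lia. Qed.

Lemma coder_degree : has_degree (3 - 2 * k%:Z) (coder mu).
Proof.
move=> i x /homog_span; apply: linear_lspan.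
- exact: linearP.
- exact: homog0.
- by move=> c y z; exact: homogL.
move=> _ [s <- ->]; rewrite coder_lword.
have QD X Y : homog (sdeg s + (3 - 2 * k%:Z)) X -> homog (sdeg s + (3 - 2 * k%:Z)) Y ->
    homog (sdeg s + (3 - 2 * k%:Z)) (X + Y : TA A).
  by move=> hX hY; rewrite -[X]scale1r; exact: homogL.
apply: cutsum_closed => // u t es; apply: cutsum_closed => // v z et.
rewrite /coder_kernel; case: eqP => [e|_]; last exact: homog0.
rewrite -[_ *: _]addr0; apply: homogL; last exact: homog0.
have -> : sdeg s + (3 - 2 * k%:Z) = sdeg (u ++ mu_letter v :: z).
  by rewrite -es -et !sdeg_cat sdeg_cons sdeg_mu_letter //; lia.
exact: homog_lword.
Qed.

(** By [shsum_mark] for the letter mu v.  The degree of this letter differs from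
    that of v by an odd number; the resulting extra sign is that of moving y
    past the odd operator, hence g = 1. *)
Lemma coder_kernel_spread : spread 1 coder_kernel.
Proof.
move=> y u v z; rewrite mul1r -cutsumZ.
have shiftE y1 y2 : shift3 y1 [::] y2 coder_kernel u v z =
    ksign R (sdeg u * sdeg y2 + sdeg v * sdeg y2) *:
    shsum y1 u (fun u' => shsum y2 z (coder_kernel u' v)).
  rewrite /shift3 sdeg0 add0r; congr (_ *: _).
  by apply: eq_shsum => u' _ _; rewrite shsum0s.
have [e|ne] := eqVneq (size v) k; last first.
  have K0 u' z' : coder_kernel u' v z' = 0 by rewrite /coder_kernel (negbTE ne).
  rewrite K0 (linear_fun0 (shuffle_linearr _)) -[LHS](cutsum_const0 (TA A) y).
  apply: eq_cutsum => y1 y2 _; rewrite shiftE.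
  under eq_shsum => u' _ _ do [under eq_shsum do rewrite K0; rewrite shsum_const0].
  by rewrite shsum_const0 !scaler0.
have KE u' z' : coder_kernel u' v z' =
    ksign R (sdeg u' + mu_sign v) *: lword (u' ++ mu_letter v :: z').
  by rewrite /coder_kernel e eqxx.
rewrite KE -[X in shuffle _ X]addr0 shuffle_linearr.
rewrite (linear_fun0 (shuffle_linearr _)) addr0 shuffle_lword shsum_mark -cutsumZ.
apply: eq_cutsum => y1 y2 ey; rewrite shiftE !scalerA -!ksignD -shsumZ -[RHS]shsumZ.
apply: eq_shsum => u' _ eu; rewrite -shsumZ -[RHS]shsumZ; apply: eq_shsum => z' _ _.
rewrite KE !scalerA -!ksignD; congr (_ *: _).
rewrite -ey eu !sdeg_cat sdeg_cons sdeg_mu_letter // sdeg0.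
apply: eq_ksign; rewrite !(oddzD, oddzM, oddzN).
by case: (oddz (sdeg u)); case: (oddz (sdeg v)); case: (oddz (sdeg y1));
  case: (oddz (sdeg y2)); case: (oddz (mu_sign v)).
Qed.
End Coderivation.

(** * Operator-order and iterated commutators *)

Section Masks.

(** Sums over subsets of a finite ordinal, as a recursion that decides the
    membership of the indices one after the other. *)
Fixpoint mask_sum (V : nmodType) n (F : seq bool -> V) : V :=
  if n is n'.+1 then
    mask_sum n' (fun bs => F (true :: bs)) +
    mask_sum n' (fun bs => F (false :: bs))
  else F [::].

Lemma eq_mask_sum (V : nmodType) n (F G : seq bool -> V) :
  (forall bs, size bs = n -> F bs = G bs) -> mask_sum n F = mask_sum n G.
Proof.
elim: n F G => [|n IHn] F G h /=; first exact: h.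
by congr (_ + _); apply: IHn => bs e; rewrite h //= e.
Qed.

Lemma mask_sumD (V : nmodType) n (F G : seq bool -> V) :
  mask_sum n (fun bs => F bs + G bs) = mask_sum n F + mask_sum n G.
Proof. by elim: n F G => //= n IHn F G; rewrite !IHn addrACA. Qed.

Definition set_mask n (I : {set 'I_n}) : seq bool := [seq i \in I | i : 'I_n].

Lemma sum_set_mask (V : nmodType) n (F : seq bool -> V) :
  \sum_(I : {set 'I_n}) F (set_mask I) = mask_sum n F.
Proof.
elim: n F => [|n IHn] F.
  rewrite (big_pred1 set0) => [|I]; last first.
    by apply/esym/eqP/setP => [[]].
  by congr F; apply/size0nil; rewrite size_map size_enum_ord.
(* A subset of n + 1 points: the membership of 0 and a subset of the rest. *)
pose ext (p : bool * {set 'I_n}) : {set 'I_n.+1} :=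
  [set i | if unlift ord0 i is Some j then j \in p.2 else p.1].
pose res (I : {set 'I_n.+1}) := (ord0 \in I, [set j | lift ord0 j \in I]).
rewrite (reindex ext) /=; last first.
  exists res => [[b J] _|I _].
    congr pair; first by rewrite inE unlift_none.
    by apply/setP => j; rewrite !inE liftK.
  by apply/setP => i; rewrite inE; case: unliftP => [j|] ->; rewrite ?inE.
have extE p : set_mask (ext p) = p.1 :: set_mask p.2.
  rewrite /set_mask /image_mem enum_ordSl map_cons inE unlift_none -map_comp.
  by congr cons; apply: eq_map => j /=; rewrite inE liftK.
under eq_bigr do rewrite extE.
rewrite -(pair_big xpredT xpredT (fun b (J : {set 'I_n}) => F (b :: set_mask J))).
by rewrite big_bool /= -!IHn.
Qed.

Definition isum (ds : seq int) : int := \sum_(d <- ds) d.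

(** The Koszul exponent for moving the entries with mark true to the front. *)
Fixpoint mask_koszul (bs : seq bool) (ds : seq int) : int :=
  match bs, ds with
  | b :: bs', d :: ds' =>
      (if b then 0 else d * isum (mask bs' ds')) + mask_koszul bs' ds'
  | _, _ => 0
  end.

Lemma mask_image n (T : Type) (b : pred 'I_n) (f : 'I_n -> T) :
  mask [seq b i | i : 'I_n] [seq f i | i : 'I_n] = [seq f i | i in b].
Proof.
rewrite /image_mem -map_mask -filter_mask; congr map.
by rewrite enumT; apply: eq_filter => i.
Qed.

Lemma sum_koszul n (ds : 'I_n -> int) (b : pred 'I_n) :
  \sum_(p < n) \sum_(q < n | [&& (p < q)%N, ~~ b p & b q]) ds p * ds q =
  mask_koszul [seq b i | i : 'I_n] [seq ds i | i : 'I_n].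
Proof.
elim: n ds b => [|n IHn] ds b.
  by rewrite big_ord0 /image_mem; case: (enum _) => [|[]].
have IH := IHn (ds \o lift ord0) (b \o lift ord0).
have ME := mask_image (b \o lift ord0) (ds \o lift ord0).
rewrite /image_mem /= in IH ME.
rewrite /image_mem enum_ordSl !map_cons -!(map_comp _ (lift ord0)) /= -IH ME.
rewrite big_ord_recl; congr (_ + _); last first.
  apply: eq_bigr => p _ /=; rewrite big_mkcond big_ord_recl /= add0r.
  by rewrite [RHS]big_mkcond; apply: eq_bigr => q _ /=.
rewrite /isum big_mkcond big_ord_recl /= add0r big_map.
case: (b ord0) => /=; first by rewrite big1.
by rewrite big_enum big_distrr /= [RHS]big_mkcond.
Qed.

Lemma koszul_exponentE n (ds : 'I_n -> int) (I : {set 'I_n}) :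
  koszul_exponent ds I = mask_koszul (set_mask I) [seq ds i | i : 'I_n].
Proof. by rewrite -(sum_koszul ds (fun i => i \in I)) pair_big_dep. Qed.
End Masks.

Section Brackets.
Variables (R : comPzRingType) (X : gradedModule R) (mul : X -> X -> X).
Hypothesis mulP : graded_comm_algebra mul.
Implicit Types (x y : X) (xs : seq X) (ds : seq int) (T : X -> X).

(** The graded commutator of T with multiplication by x, for T of degree g and x
    of degree d. *)
Definition bracket g d x T : X -> X :=
  fun y => T (mul x y) - ksign R (g * d) *: mul x (T y).

Fixpoint brackets g ds xs T : X -> X :=
  match ds, xs with
  | d :: ds', x :: xs' => brackets (g + d) ds' xs' (bracket g d x T)
  | _, _ => T
  end.

(** The product x_1 * (x_2 * ... * (x_n * y)), which for an arbitrary y works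
    as a multiplication operator. *)
Definition lmuls xs y := foldr mul y xs.

Lemma linear_lmuls xs : linear (lmuls xs).
Proof.
elim: xs => [|x xs IH] c u v //=.
by rewrite IH (gca_linearr mulP).
Qed.

Lemma linear_bracket g d x T : linear T -> linear (bracket g d x T).
Proof.
move=> Tl c u v; have lr := gca_linearr mulP x.
rewrite /bracket lr !Tl lr !scalerDr scalerN !scalerA.
by rewrite [_ * c]mulrC opprD addrACA.
Qed.

Lemma lmulsCA ds xs d x y : homogs ds xs -> homog d x ->
  lmuls xs (mul x y) = ksign R (d * isum ds) *: mul x (lmuls xs y).
Proof.
move=> + hx; elim: xs ds => [|z xs IH] [|e ds] //=.
  by rewrite /isum big_nil mulr0 scale1r.
case=> hz /IH ->; have lr := gca_linearr mulP z.
rewrite -[X in mul z X]addr0 lr (linear_fun0 lr) addr0.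
rewrite !(gca_assoc mulP) (gca_comm mulP hz hx).
rewrite -[X in mul X _]addr0 (gca_linearl mulP).
rewrite (linear_fun0 (gca_linearl mulP _)) addr0 scalerA -ksignD.
by congr (_ *: _); rewrite /isum big_cons; sign_eq.
Qed.

Definition unmask (E : Type) (bs : seq bool) (xs : seq E) := mask (map negb bs) xs.

(** The exponent of the term of the iterated commutator in which the x_i with
    mark true are multiplied inside T and the others outside.  An outside factor
    passes T, of degree g, with the coefficient -1 of the commutator, and passes
    the inside factors that precede it. *)
Fixpoint brackets_sign g (bs : seq bool) ds : int :=
  match bs, ds with
  | b :: bs', d :: ds' =>
      (if b then d * isum (unmask bs' ds') else g * d + 1) +
      brackets_sign g bs' ds'
  | _, _ => 0
  end.

Lemma homogs_mask (bs : seq bool) ds xs :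
  homogs ds xs -> homogs (mask bs ds) (mask bs xs).
Proof.
elim: bs ds xs => [|b bs IH] [|d ds] [|x xs] //= [hx /IH h].
by case: b.
Qed.

(** After one commutator the operator has degree g + d: each later outside factor
    now also passes the new factor of degree d. *)
Lemma brackets_signD g d bs ds : size bs = size ds ->
  oddz (brackets_sign (g + d) bs ds) =
  oddz (brackets_sign g bs ds + d * isum (unmask bs ds)).
Proof.
rewrite /unmask; elim: bs ds => [|b bs IH] [|e ds] //=.
  by rewrite /isum big_nil mulr0.
case=> /IH; case: b; rewrite /= /isum ?big_cons !(oddzD, oddzM) => ->;
  by oddz_cases.
Qed.

(** By induction, each commutator having one term with x inside T and one with x
    outside; in the latter x still has to be moved to the front of the later
    outside factors. *)
Lemma brackets_expand g ds xs T y : linear T -> homogs ds xs ->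
  brackets g ds xs T y = mask_sum (size xs) (fun bs =>
    ksign R (brackets_sign g bs ds) *:
      lmuls (unmask bs xs) (T (lmuls (mask bs xs) y))).
Proof.
elim: xs ds g T => [|x xs IH] [|d ds] g T //= Tl.
  by move=> _; rewrite scale1r.
case=> hx hxs; rewrite (IH _ _ _ (linear_bracket _ _ _ Tl) hxs) -mask_sumD.
apply: eq_mask_sum => bs sz.
have szd : size bs = size ds by rewrite sz (homogs_size hxs).
have -> : lmuls (unmask bs xs) (bracket g d x T (lmuls (mask bs xs) y)) =
    lmuls (unmask bs xs) (T (mul x (lmuls (mask bs xs) y))) -
    ksign R (g * d + d * isum (unmask bs ds)) *:
      mul x (lmuls (unmask bs xs) (T (lmuls (mask bs xs) y))).
  rewrite /bracket addrC -scaleNr linear_lmuls.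
  rewrite (lmulsCA _ (homogs_mask _ hxs) hx) scalerA mulNr -ksignD scaleNr addrC.
  by [].
rewrite scalerBr scalerA -ksignD -scaleNr; congr (_ *: _ + _ *: _).
  by apply: eq_ksign; rewrite brackets_signD // addrC.
have -> : - ksign R (brackets_sign (g + d) bs ds + (g * d + d * isum (unmask bs ds)))
  = ksign R (1 + (brackets_sign (g + d) bs ds + (g * d + d * isum (unmask bs ds)))).
  by rewrite [RHS]ksignD mulN1r.
apply: eq_ksign; rewrite !oddzD brackets_signD // !oddzD.
by oddz_cases.
Qed.

Lemma lmuls_homog ds xs d y : homogs ds xs -> homog d y ->
  homog (isum ds + d) (lmuls xs y).
Proof.
move=> + hy; elim: xs ds => [|x xs IH] [|e ds] //=.
  by rewrite /isum big_nil add0r.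
by case=> hx /IH h; rewrite /isum big_cons -addrA; exact: (gca_homog mulP).
Qed.

Lemma lmuls_mul xs y z : lmuls xs (mul y z) = mul (lmuls xs y) z.
Proof. by elim: xs => //= x xs ->; rewrite (gca_assoc mulP). Qed.

(** For g = 1 the exponent agrees with the one in the definition of
    operator-order, up to the sign of moving T and the inside factors in front of
    the outside ones: of two factors, one inside and one outside, either the
    outside one comes first or the inside one does. *)
Lemma brackets_sign1 bs ds : size bs = size ds ->
  oddz (brackets_sign 1 bs ds) =
  oddz ((size (unmask bs ds))%:Z + mask_koszul bs ds +
       (isum (mask bs ds) + 1) * isum (unmask bs ds)).
Proof.
rewrite /unmask; elim: bs ds => [|b bs IH] [|d ds] //=.
  by rewrite /isum big_nil mulr0.
case=> /IH; case: b; rewrite /= /isum ?big_cons ?intS !(oddzD, oddzM) => ->;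
  by oddz_cases.
Qed.

Lemma mask_set n (I : {set 'I_n}) (E : Type) (f : 'I_n -> E) :
  mask (set_mask I) [seq f i | i : 'I_n] = [seq f i | i in I].
Proof. by rewrite mask_image. Qed.

Lemma unmask_set n (I : {set 'I_n}) (E : Type) (f : 'I_n -> E) :
  unmask (set_mask I) [seq f i | i : 'I_n] = [seq f i | i in ~: I].
Proof.
rewrite /unmask /set_mask /image_mem -map_comp.
have := mask_image (fun i => i \notin I) f; rewrite /image_mem => ->.
by congr map; apply: eq_enum => i; rewrite inE.
Qed.

(** The term of the empty subset, missing in the definition of operator-order,
    contains D u = 0. *)
Lemma operator_order_brackets n (D : X -> X) e u :
  linear D -> has_degree e D -> oddz e ->
  homog 0 u -> left_id u mul -> right_id u mul -> D u = 0 ->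
  (forall ds xs, homogs ds xs -> size xs = n.+1 -> brackets 1 ds xs D u = 0) ->
  operator_order mul n D.
Proof.
move=> Dl De e1 hu ul ur Du hD ds x hx.
set es := [seq ds i | i : 'I_n.+1]; set xs := [seq x i | i : 'I_n.+1].
have hxs : homogs es xs.
  rewrite /es /xs /image_mem; elim: (enum _) => //= i s IH; split=> //; exact: hx.
have sxs : size xs = n.+1 by rewrite size_map size_enum_ord.
have := hD _ _ hxs sxs; rewrite brackets_expand // sxs -sum_set_mask.
apply: etrans.
rewrite [RHS](bigD1 set0) //= mask_set.
have -> : [seq x i | i in (set0 : {set 'I_n.+1})] = [::].
  by rewrite /image_mem enum_set0.
rewrite Du.
rewrite (linear_fun0 (linear_lmuls _)) scaler0 add0r.
apply: eq_bigr => I I0; rewrite unmask_set mask_set.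
have szI : size (set_mask I) = size es by rewrite !size_map.
set F := [seq x i | i in ~: I]; set M := [seq x i | i in I].
have foldlE y s : foldl mul y s = mul y (lmuls s u).
  elim: s y => [|z s IH] y /=; first by rewrite ur.
  by rewrite IH (gca_assoc mulP).
have -> : mprod mul M = lmuls M u.
  case eM: M => [|z s]; last by rewrite /= foldlE.
  case/set0Pn: I0 => i iI; have : i \in enum I by rewrite mem_enum.
  by move: eM; rewrite /M /image_mem; case: (enum _).
have hM : homog (isum (mask (set_mask I) es)) (lmuls M u).
  rewrite -[isum _]addr0; apply: lmuls_homog => //.
  by rewrite /M -mask_set; exact: homogs_mask.
have hF : homog (isum (unmask (set_mask I) es)) (lmuls F u).
  rewrite -[isum _]addr0; apply: lmuls_homog => //.
  by rewrite /F -unmask_set; exact: homogs_mask.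
rewrite /= foldlE (gca_comm mulP (De _ _ hM) hF) -lmuls_mul ul scalerA -ksignD.
congr (_ *: _); apply: eq_ksign.
have sF : size (unmask (set_mask I) es) = (n.+1 - #|I|)%N.
  rewrite unmask_set size_map -cardE [in RHS]cardsCs card_ord subKn //.
  by rewrite -[leqRHS]card_ord max_card.
rewrite brackets_sign1 // sF koszul_exponentE !(oddzD, oddzM) e1.
by oddz_cases.
Qed.
End Brackets.

(** * Local operators *)

Section LocalOperators.
Variables (R : comPzRingType) (A : gradedModule R).
Local Notation lword := (@lword R A).
Local Notation mul := (@shuffle R A).
Implicit Types (s t u v w x y z : seq (letter A)).
Implicit Types (T : TA A -> TA A).

(** An operator which sums over the cuts of a word in three pieces and looks at
    fewer than m letters in the middle one. *)
Record local_operator (m : nat) (g : int) T : Prop := LocalOperator {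
  local_linear : linear T;
  local_kernel : exists H, [/\ forall w, T (lword w) = cutsum3 w H,
    forall u v z, (m <= size v)%N -> H u v z = 0 & spread g H]
}.

Lemma local0 m g : local_operator m g (fun=> 0).
Proof.
split; first by move=> c X Y; rewrite scaler0 addr0.
exists (fun _ _ _ => 0); split=> // [w|y u v z].
  by rewrite /cutsum3; under eq_cutsum do rewrite cutsum_const0; rewrite cutsum_const0.
rewrite (linear_fun0 (shuffle_linearr _)).
by under eq_cutsum do rewrite shift3_const0; rewrite cutsum_const0 scaler0.
Qed.

Lemma localD m g c T1 T2 : local_operator m g T1 -> local_operator m g T2 ->
  local_operator m g (fun X => c *: T1 X + T2 X).
Proof.
case=> l1 [H1 [E1 Z1 S1]] [l2 [H2 [E2 Z2 S2]]]; split.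
  move=> d X Y; rewrite l1 l2 !scalerDr !scalerA [c * d]mulrC.
  by rewrite addrACA.
exists (fun u v z => c *: H1 u v z + H2 u v z); split.
- move=> w; rewrite E1 E2 /cutsum3 -cutsum_linear; apply: eq_cutsum => u t _.
  by rewrite -cutsum_linear.
- by move=> u v z h; rewrite Z1 // Z2 // scaler0 addr0.
- exact: spreadD.
Qed.

Lemma local_operator0 g T X : local_operator 0 g T -> T X = 0.
Proof.
case=> Tl [H [E Z _]]; have [l0 _] := local0 0 g.
apply: (linear_eq_lspan Tl l0 _ (lword_span X)) => _ [w ->].
rewrite E /cutsum3; under eq_cutsum => u t _.
  under eq_cutsum => v z _ do rewrite Z //.
  rewrite cutsum_const0; over.
by rewrite cutsum_const0.
Qed.

(** The kernel of the commutator is the sum of the shifts of H over the cuts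
    x1 x2 x3 of x (P) minus that over the cuts with x2 empty (N); the latter is
    the kernel of multiplication by x after T, because H spreads x. *)
Lemma local_bracket_lword m g x T : local_operator m.+1 g T ->
  local_operator m (g + sdeg x) (bracket mul g (sdeg x) (lword x) T).
Proof.
case=> Tl [H [E Z S]]; split.
  by apply: linear_bracket => //; exact: shuffle_algebra.
pose N u v z := cutsum x (fun x1 x2 => shift3 x1 [::] x2 H u v z).
pose P u v z := cutsum3 x (fun x1 x2 x3 => shift3 x1 x2 x3 H u v z).
exists (fun u v z => (-1) *: N u v z + P u v z); split.
- move=> w; rewrite /bracket shuffle_lword (linear_shsum _ _ _ Tl) E.
  rewrite (eq_shsum (F' := fun w' => cutsum3 w' H)) => [|w' _ _]; last exact: E.
  rewrite shsum_cut3 addrC -scaleNr /cutsum3.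
  rewrite (linear_cutsum _ _ (shuffle_linearr (lword x))) -cutsumZ -cutsumD.
  apply: eq_cutsum => u t _.
  rewrite (linear_cutsum _ _ (shuffle_linearr (lword x))) -cutsumZ -cutsumD.
  apply: eq_cutsum => v z _; rewrite S scalerA mulNr -ksignD; congr (_ *: _ + _).
  by rewrite ksignE oddzD addbb.
- move=> u v z mv; rewrite /N /P /cutsum3 -cutsumZ -cutsumD.
  apply: etrans (cutsum_const0 _ x).
  apply: eq_cutsum => x1 t _; rewrite [cutsum t _]cutsum_head ?scaleN1r ?addNr //.
  move=> x2 x3 _ x2_gt0; rewrite /shift3; apply: etrans (scaler0 _ _).
  congr (_ *: _); apply: etrans (shsum_const0 _ x1 u); apply: eq_shsum => u' _ _.
  apply: etrans (shsum_const0 _ x2 v); apply: eq_shsum => v' sv' _.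
  apply: etrans (shsum_const0 _ x3 z); apply: eq_shsum => z' _ _.
  by apply: Z; rewrite sv'; lia.
- apply: spreadD.
    apply: spread_cutsum => p q <-; rewrite sdeg_cat.
    have -> : sdeg p + sdeg q = sdeg p + @sdeg R A [::] + sdeg q by rewrite sdeg0 addr0.
    exact: spread_shift3.
  apply: spread_cutsum => p t e; apply: spread_cutsum => q r e'.
  by rewrite -e -e' !sdeg_cat [sdeg p + _]addrA; exact: spread_shift3.
Qed.

Lemma local_bracket m g d (X : TA A) T : local_operator m.+1 g T -> homog d X ->
  local_operator m (g + d) (bracket mul g d X T).
Proof.
move=> hT /homog_span; elim=> [|c _ Y [s <- ->] _ IH].
  have -> : bracket mul g d 0 T = fun=> 0; last exact: local0.
  apply/funext => Z; rewrite /bracket.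
  rewrite !(linear_fun0 (shuffle_linearl _)) (linear_fun0 (local_linear hT)).
  by rewrite scaler0 subr0.
have -> : bracket mul g (sdeg s) (c *: lword s + Y) T = fun Z =>
    c *: bracket mul g (sdeg s) (lword s) T Z + bracket mul g (sdeg s) Y T Z.
  apply/funext => Z; rewrite /bracket !shuffle_linearl (local_linear hT).
  rewrite !scalerDr scalerN !scalerA [_ * c]mulrC opprD.
  by rewrite addrACA.
by apply: localD => //; exact: local_bracket_lword.
Qed.

Lemma local_brackets m g ds (xs : seq (TA A)) T : local_operator m g T ->
  homogs ds xs -> size xs = m -> forall X, brackets mul g ds xs T X = 0.
Proof.
elim: xs ds m g T => [|x xs IH] [|d ds] m g T //= hT.
  by move=> _ m0 X; rewrite -m0 in hT; exact: local_operator0 hT.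
case: m hT => // m hT [hx hxs] [sz] X.
exact: (IH _ _ _ _ (local_bracket hT hx)).
Qed.
End LocalOperators.

Section Main.
Variables (R : comPzRingType) (A : gradedModule R).

Lemma coder_local k (mu : {linear tpow A k -> A}) :
  (forall (ds : seq int) (t : k.-tuple A), homogs ds t ->
     homog (\sum_(d <- ds) d + 2 - k%:Z) (mu (tprod t))) ->
  local_operator k.+1 1 (coder mu).
Proof.
move=> hmu; split; first exact: linearP.
exists (coder_kernel hmu); split; first exact: coder_lword.
  by move=> u v z kv; rewrite /coder_kernel gtn_eqF.
exact: coder_kernel_spread.
Qed.

Lemma coder_operator_order k (mu : {linear tpow A k -> A}) : (0 < k)%N ->
  (forall (ds : seq int) (t : k.-tuple A), homogs ds t ->
     homog (\sum_(d <- ds) d + 2 - k%:Z) (mu (tprod t))) ->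
  operator_order (@shuffle R A) k (coder mu).
Proof.
move=> k0 hmu; have mulP := shuffle_algebra A.
apply: (operator_order_brackets mulP (e := 3 - 2 * k%:Z) (u := lword [::])).
- exact: linearP.
- exact: coder_degree.
- by rewrite oddzD oddzN oddzM.
- exact: homog_unit.
- exact: shuffle1l.
- exact: shuffle1r.
- rewrite (coder_lword hmu) /cutsum3 !cutsum0 /coder_kernel /=.
  by rewrite ltn_eqF.
- by move=> ds xs h sz; apply: local_brackets h sz _; exact: coder_local.
Qed.

(** The coderivation of a unary map is local of width 2, so its double commutator
    with X and Y vanishes; at the unit this reads as the Leibniz rule, once Y is
    moved behind the image of X. *)
Lemma coder_leibniz (mu : {linear tpow A 1 -> A}) :
  (forall (ds : seq int) (t : 1.-tuple A), homogs ds t ->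
     homog (\sum_(d <- ds) d + 2 - 1%:Z) (mu (tprod t))) ->
  forall i (X Y : TA A), homog i X ->
  coder mu (shuffle X Y) =
  shuffle (coder mu X) Y + ksign R i *: shuffle X (coder mu Y).
Proof.
move=> hmu i X Y hX; pose d := coder mu.
have dl : linear d by exact: linearP.
have d1 : d (lword [::]) = 0 by rewrite /d (coder_lword hmu) /cutsum3 !cutsum0.
apply: (linear_eq_lspan (f := fun Y => d (shuffle X Y))
  (g := fun Y => shuffle (d X) Y + _ *: shuffle X (d Y)) _ _ _ (lword_span Y)).
- exact: (linear_comp dl (shuffle_linearr X)).
- move=> c u v; rewrite dl !shuffle_linearr !scalerDr !scalerA [_ * c]mulrC.
  by rewrite addrACA.
move=> _ [t ->].
have hXt : homogs [:: i; sdeg t] [:: X; lword t] by do 2!split=> //; exact: homog_lword.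
have := local_brackets (coder_local hmu) hXt erefl (lword [::]).
rewrite /= /bracket !shuffle1r -/d d1 (linear_fun0 (shuffle_linearr _)).
rewrite scaler0 subr0 mul1r => /eqP; rewrite subr_eq0 subr_eq => /eqP ->.
congr (_ + _); have dX : homog (i + 1) (d X) by exact: (coder_degree hmu).
rewrite [shuffle (d X) _](shuffle_comm dX (homog_lword t)).
by rewrite [1 + i]addrC.
Qed.
End Main.

Theorem theorem2 (R : comPzRingType) (A : gradedModule R)
    (mu : forall k : nat, {linear tpow A k -> A}) :
  A_infinity mu ->
  BV_infinity (@shuffle R A) (fun k : nat => coder (mu k)).
Proof.
case=> hdeg hrel.
have deg k : (0 < k)%N -> has_degree (3 - 2 * k%:Z) (coder (mu k)).
  by move=> k0; apply: coder_degree => ds t; exact: hdeg.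
have ord k : (0 < k)%N -> operator_order (@shuffle R A) k (coder (mu k)).
  by move=> k0; apply: coder_operator_order => // ds t; exact: hdeg.
split=> //.
have deg1 : has_degree 1 (coder (mu 1%N)) := deg 1%N isT.
split=> //; first exact: shuffle_algebra.
  by move=> x; have := hrel 2%N x; rewrite big_nat1.
by apply: coder_leibniz => ds t; exact: hdeg.
Qed.
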